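(* Let $A$ be the open annulus, let $f:A\to A$ be a continuous map of degree $d$, and let $K\subset A$ be a locally connected essential continuum such that $f(K)\subset K$. If $|d|>1$, then $f$ is complete on $\mathrm{Fill}(K)$.
   Context: $A$ is the open annulus (e.g. $\mathbb{R}^2\setminus\{0\}$, homeomorphic to $S^1\times(0,1)$). The degree of a continuous map $f:A\to A$ is the integer $d$ such that the endomorphism $f_*$ of $\pi_1(A)\cong\mathbb{Z}$ induced by $f$ is multiplication by $d$. A continuum is a nonempty compact connected set. A continuum $K\subset A$ is essential if it separates the two ends of $A$, i.e. the two ends of $A$ lie in different components of the complement of $K$ in the two-point (end) compactification of $A$. For compact $K\subset A$, $\mathrm{Fill}(K)$ is the union of $K$ with the relatively compact (in $A$) connected components of $A\setminus K$. Nielsen equivalence: two fixed points $p,q$ of a continuous map $g:A\to A$ are Nielsen equivalent if there is a curve $\gamma$ in $A$ joining $p$ to $q$ such that $g\circ\gamma$ is homotopic to $\gamma$ relative to endpoints. The equivalence classes are the Nielsen classes of fixed points of $g$. A degree $d$ map $f:A\to A$ is complete if for every $n\ge 1$ the number of Nielsen classes of fixed points of $f^n$ is equal to $|d^n-1|$. It is complete on a set $L\subset A$ if it is complete and, for every $n\geq 1$, every Nielsen class of fixed points of $f^n$ has a representative in $L$. *)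

(* Defs.v *)
From mathcomp Require Import all_boot all_order all_algebra.
From mathcomp Require Import all_classical all_reals all_analysis.

Set Implicit Arguments.
Unset Strict Implicit.
Unset Printing Implicit Defensive.

Import Order.TTheory GRing.Theory Num.Theory.
Import numFieldNormedType.Exports.

Local Open Scope classical_set_scope.
Local Open Scope ring_scope.

(* The punctured plane.  Used as a type (through the coercion [set_type]), it
   carries the subtype topology. *)
Definition annulus (R : realType) : set (R * R) := ~` [set (0, 0)].
Arguments annulus : clear implicits.

Section Paths.
Context {R : realType} {T : topologicalType}.
Implicit Types (g a b : R -> T) (x y : T).

(* Paths are total functions on [R], of which only the restriction to [0, 1]
   is meaningful. *)
Definition is_path x y g : Prop :=
  [/\ {within `[0, 1], continuous g}, g 0 = x & g 1 = y].

Definition path_rev g : R -> T := fun t => g (1 - t).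

Definition path_cat a b : R -> T :=
  fun t => if t <= 2^-1 then a (2 * t) else b (2 * t - 1).

Definition loop_pow g (m : int) : R -> T :=
  match m with
  | Posz n => iter n (path_cat g) (cst (g 0))
  | Negz n => iter n.+1 (path_cat (path_rev g)) (cst (g 0))
  end.

(* Homotopy relative to endpoints; [H (s, t)] is the path of parameter [s]
   evaluated at time [t]. *)
Definition path_homotopic a b : Prop :=
  exists H : R * R -> T,
    [/\ {within `[0, 1] `*` `[0, 1], continuous H},
        forall t, t \in `[0, 1] -> H (0, t) = a t,
        forall t, t \in `[0, 1] -> H (1, t) = b t
      & forall s, s \in `[0, 1] -> H (s, 0) = a 0 /\ H (s, 1) = a 1].

End Paths.

(* For every base point [p] and every path [a] from [p] to [f p], the
   composite of [f_* : pi_1(A, p) -> pi_1(A, f p)] with the change of base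
   point isomorphism [pi_1(A, f p) -> pi_1(A, p)] along [a] sends the class of
   a loop [g] to its [d]-th power.  As [pi_1(A, p)] is infinite cyclic, this
   power is multiplication by [d], and the isomorphism does not depend on [a]. *)
Definition has_degree (R : realType) (f : annulus R -> annulus R) (d : int) :
    Prop :=
  forall (p : annulus R) (a g : R -> annulus R),
    is_path p (f p) a -> is_path p p g ->
    path_homotopic (path_cat (path_cat a (f \o g)) (path_rev a))
                   (loop_pow g d).

Definition continuum (T : topologicalType) (K : set T) : Prop :=
  [/\ K !=set0, compact K & connected K].

(* [K], with its subspace topology, has a base of connected open sets. *)
Definition locally_connected (T : topologicalType) (K : set T) : Prop :=
  forall (x : T) (U : set T), K x -> open U -> U x ->
    exists W : set T,
      [/\ open W, W x, K `&` W `<=` U & connected (K `&` W)].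

(* The end compactification of the punctured plane is the one-point
   compactification of the plane, its two ends being the origin and the point
   at infinity [None]. *)
Definition to_ends_compactification (R : realType) (z : annulus R) :
    one_point_compactification (R * R)%type :=
  Some (\val z).

Definition essential (R : realType) (K : set (annulus R)) : Prop :=
  let E := ~` (@to_ends_compactification R @` K) in
  connected_component E (Some (0, 0)) <> connected_component E None.

(* Closures are taken in [T]: a component is filled in when it is relatively
   compact in [T]. *)
Definition Fill (T : topologicalType) (K : set T) : set T :=
  K `|` [set x | ~ K x /\ compact (closure (connected_component (~` K) x))].

Section Nielsen.
Context {R : realType}.
Implicit Types (f g : annulus R -> annulus R) (p q : annulus R).

Definition fixed_points g : set (annulus R) := [set p | g p = p].

Definition nielsen_equiv g p q : Prop :=
  exists c : R -> annulus R, is_path p q c /\ path_homotopic (g \o c) c.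

Definition nielsen_class g p : set (annulus R) :=
  [set q | fixed_points g q /\ nielsen_equiv g p q].

Definition nielsen_classes g : set (set (annulus R)) :=
  [set nielsen_class g p | p in fixed_points g].

(* [f] is meant to have degree [d]. *)
Definition nielsen_complete (d : int) f : Prop :=
  forall n : nat, (1 <= n)%N ->
    (nielsen_classes (iter n f) #= `I_(absz (d ^+ n - 1)))%card.

Definition nielsen_complete_on (d : int) f (L : set (annulus R)) : Prop :=
  nielsen_complete d f /\
  forall n : nat, (1 <= n)%N ->
    forall C, nielsen_classes (iter n f) C -> C `&` L !=set0.

End Nielsen.

(* Main.v *)
Require Import Defs.
From mathcomp Require Import all_boot all_order all_algebra.
From mathcomp Require Import all_classical all_reals all_analysis.
From mathcomp Require Import ring lra.
Import Order.TTheory GRing.Theory Num.Theory.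
Import numFieldNormedType.Exports.
Local Open Scope classical_set_scope.
Local Open Scope ring_scope.
Set Implicit Arguments.
Unset Strict Implicit.
Unset Printing Implicit Defensive.

(** * Nielsen classes of annulus maps preserving an essential continuum *)

(** The plane covers the annulus through
    [(x, y) |-> e^y (cos (2 pi x), sin (2 pi x))], the deck transformations being
    the integral horizontal translations.  A map [g] of degree [D] has a lift [G]
    with [G (z + 1) = G z + D].  If [z] lies over a fixed point of [g], then
    [G z = z + k] for an integer [k], its index; moving [z] to [z + n] adds
    [(D - 1) n] to the index.  Lifting homotopies in one direction and using
    linear homotopies in the plane in the other, two fixed points are Nielsen
    equivalent if and only if their indices agree modulo [D - 1]
    ([nielsen_equiv_index]).  The powers of [f] have the degrees [d ^+ n], which
    are different from [1].  So both assertions follow once every lift of such a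
    power, that is every map [G - k], has a fixed point over [Fill K]
    ([lift_fixed_in_Fill], [nielsen_complete_lift]).

    This is a statement on the plane ([plane_fixed_point]). Let [L] be the
    preimage of [K], let [F] be a lift preserving [L], with [F (z + 1) = F z +
    D] and [D <> 1], and assume that the displacement [V z = z - F z] has no
    zero in the set of points from which one cannot escape upwards or downwards
    without crossing [L]. On a large rectangle, close to that set, [V] points to
    the right along one vertical side and to the left along the other one. The
    turning of [V] along the edges of a fine grid in the rectangle is defined so
    that it sums to zero around each small square, hence around the rectangle,
    and this contradicts the values on the vertical sides.

    The difficulty is to define the turning above and below [L], where [V] may
    have zeros.  It is taken there to be the variation of a function [psi],
    which only needs to be a determination of the angle of [V] at points close
    to [L] ([upper_branch]).  To find it, look at [L] from a point [z] above it.
    For [y] in [L], the angle of [z - y] has a preferred determination: move [z]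
    to the top of the plane without crossing [L], and ask that the angle ends
    between [0] and [pi].  That this does not depend on the path is where the
    connectedness of [K] and the separation of the two ends are used
    ([view_angle_uniq]).  If [z] is close to a point [q] of [L], then [F q] is
    again in [L] and [V z] is close to [z - F q], whose preferred determination
    gives [psi z].  Another choice of [q] can be joined to the first one by a small
    connected subset of [L], because [K] is locally connected; therefore the
    choice is immaterial, and [psi] follows the angle of [V] as long as [z] does
    not cross [L]. *)

(** * Angles of plane vectors *)

Section Angles.
Context {R : realType}.
Implicit Types (u v w : R * R) (a b : R).

Definition dotp u v : R := u.1 * v.1 + u.2 * v.2.
Definition crossp u v : R := u.1 * v.2 - u.2 * v.1.
Definition angle_of v a : Prop :=
  exists2 r : R, 0 < r & v = (r * cos a, r * sin a).
(** The signed angle from [u] to [v], meaningful when their scalar product is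
    positive; it then lies strictly between [- pi / 2] and [pi / 2]. *)
Definition parg u v : R := atan (crossp u v / dotp u v).

Lemma dotpC u v : dotp u v = dotp v u.
Proof. by rewrite /dotp; ring. Qed.

Lemma parg_bound u v : `|parg u v| < pi / 2.
Proof. by rewrite ltr_norml atan_gtNpi2 atan_ltpi2. Qed.

Lemma pargC u v : parg v u = - parg u v.
Proof. by rewrite /parg -atanN dotpC -mulNr; congr (atan (_ / _)); rewrite /crossp; ring. Qed.

Lemma parg_self u : parg u u = 0.
Proof.
have := pargC u u; set x := parg u u; move=> h; lra.
Qed.

Lemma cos_eq1_lt2pi (x : R) : cos x = 1 -> `|x| < 2 * pi -> x = 0.
Proof.
move=> cx xlt.
have e : x = (x / 2) *+ 2 by rewrite -mulr_natr; field.
have s0 : sin (x / 2) ^+ 2 = 0.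
  have : cos (x / 2 *+ 2) = 1 by rewrite -e.
  by rewrite cos_mulr2n cos2sin2 => h; lra.
have {}s0 : sin (x / 2) = 0 by apply/eqP; rewrite -sqrf_eq0 s0.
have [x0|x0|//] := ltgtP x 0.
- have : 0 < sin (- (x / 2)).
    apply: sin_gt0_pi; move: xlt; rewrite ltr0_norm// => xlt.
    by apply/andP; split; lra.
  by rewrite sinN s0 oppr0 ltxx.
- have : 0 < sin (x / 2).
    apply: sin_gt0_pi; move: xlt; rewrite gtr0_norm// => xlt.
    by apply/andP; split; lra.
  by rewrite s0 ltxx.
Qed.

Lemma angle_of_cosB v a b : angle_of v a -> angle_of v b -> cos (a - b) = 1.
Proof.
move=> [r r0 ->] [s s0 [] e1 e2].
have rs : r = s.
  apply/eqP; rewrite -(eqrXn2 (n := 2)) ?ltW//; apply/eqP.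
  rewrite -[r ^+ 2]mulr1 -[s ^+ 2]mulr1 -{1}(cos2Dsin2 a) -(cos2Dsin2 b).
  by rewrite !mulrDr -!exprMn e1 e2.
subst s.
have rn : r != 0 by rewrite gt_eqF.
move/(mulfI rn) : e1 => e1; move/(mulfI rn) : e2 => e2.
by rewrite cosB e1 e2 -!expr2 cos2Dsin2.
Qed.

Lemma angle_of_uniq v a b : angle_of v a -> angle_of v b ->
  `|a - b| < 2 * pi -> a = b.
Proof.
move=> va vb ab; apply/eqP; rewrite -subr_eq0; apply/eqP.
exact: cos_eq1_lt2pi (angle_of_cosB va vb) ab.
Qed.

Lemma angle_of_parg u v a : angle_of u a -> 0 < dotp u v ->
  angle_of v (a + parg u v).
Proof.
move=> [r r0 ue] d0; rewrite /parg.
set x := crossp u v / dotp u v.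
have c0 : 0 < cos (atan x) by apply: cos_gt0_pihalf; rewrite atan_gtNpi2 atan_ltpi2.
have st : sin (atan x) = x * cos (atan x).
  by rewrite -{2}[x]atanK /tan -mulrA mulVf ?mulr1// gt_eqF.
exists (dotp u v / (r * cos (atan x))); first by rewrite divr_gt0// mulr_gt0.
have un : u.1 ^+ 2 + u.2 ^+ 2 = r ^+ 2.
  by rewrite ue /= !exprMn -mulrDr cos2Dsin2 mulr1.
rewrite cosD sinD st.
have e1 : dotp u v * x = crossp u v by rewrite /x mulrC divfK// gt_eqF.
have rn : r != 0 by rewrite gt_eqF.
have ca : r * cos a = u.1 by rewrite ue.
have sa : r * sin a = u.2 by rewrite ue.
have cn : cos (atan x) != 0 by rewrite gt_eqF.
rewrite [LHS](surjective_pairing v); congr pair.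
- apply: (mulfI (x := r ^+ 2)); first by rewrite expf_neq0.
  transitivity (dotp u v * (r * cos a) - (dotp u v * x) * (r * sin a)); last by field; apply/andP.
  by rewrite ca sa e1 -un /dotp /crossp; ring.
- apply: (mulfI (x := r ^+ 2)); first by rewrite expf_neq0.
  transitivity (dotp u v * (r * sin a) + (dotp u v * x) * (r * cos a)); last by field; apply/andP.
  by rewrite ca sa e1 -un /dotp /crossp; ring.
Qed.

(** Both sides are angles of [v], at a distance less than
    [(pi + pi / 2) + pi / 2 = 2 * pi].  This is the form in which angles are pinned down in
    the sequel. *)
Lemma angle_of_pargP u v a b : angle_of u a -> angle_of v b -> 0 < dotp u v ->
  `|b - a| < pi + pi / 2 -> b = a + parg u v.
Proof.
move=> ua vb d0 ab; have va := angle_of_parg ua d0.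
apply: (angle_of_uniq vb va).
have := parg_bound u v; have := ler_normB (b - a) (parg u v).
rewrite opprD addrA; lra.
Qed.

Lemma angle_of_near u v a b : angle_of u a -> angle_of v b -> 0 < dotp u v ->
  `|b - a| < pi + pi / 2 -> `|b - a| < pi / 2.
Proof.
move=> ua vb d0 ab; rewrite (angle_of_pargP ua vb d0 ab).
by rewrite addrAC subrr add0r parg_bound.
Qed.

Lemma angle_of_ne0 u a : angle_of u a -> u <> (0, 0).
Proof.
move=> [r r0 ->] [] c s.
have := cos2Dsin2 a => h.
have : r ^+ 2 * (cos a ^+ 2 + sin a ^+ 2) = 0.
  by rewrite mulrDr -!exprMn c s; ring.
by rewrite h mulr1 => /eqP; rewrite sqrf_eq0 gt_eqF.
Qed.

Lemma angle_of_east : angle_of (1, 0) (0 : R).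
Proof. by exists 1; rewrite ?cos0 ?sin0 ?mul1r. Qed.
Lemma angle_of_north : angle_of (0, 1) (pi / 2 : R).
Proof. by exists 1; rewrite ?cos_pihalf ?sin_pihalf ?mul1r. Qed.
Lemma angle_of_west : angle_of (-1, 0) (pi : R).
Proof. by exists 1; rewrite ?cospi ?sinpi ?mul1r. Qed.
Lemma angle_of_south : angle_of (0, -1) (- (pi / 2) : R).
Proof. by exists 1; rewrite ?sinN ?cosN ?cos_pihalf ?sin_pihalf ?mul1r. Qed.

(** Every nonzero vector has a positive scalar product with one of the four
    unit vectors of the axes, whose angles are known. *)
Lemma angle_of_exists u : u <> (0, 0) -> exists a, angle_of u a.
Proof.
case: u => x y u0.
have [x0|x0|x0] := ltgtP x 0.
- eexists; apply: (angle_of_parg angle_of_west); rewrite /dotp/=; lra.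
- eexists; apply: (angle_of_parg angle_of_east); rewrite /dotp/=; lra.
- have [y0|y0|y0] := ltgtP y 0.
  + eexists; apply: (angle_of_parg angle_of_south); rewrite /dotp/=; lra.
  + eexists; apply: (angle_of_parg angle_of_north); rewrite /dotp/=; lra.
  + by case: u0; rewrite x0 y0.
Qed.

Lemma dotp_gt0_self u : u <> (0, 0) -> 0 < dotp u u.
Proof.
case: u => x y u0; rewrite /dotp /= -!expr2 lt_neqAle addr_ge0 ?sqr_ge0// andbT.
rewrite eq_sym paddr_eq0 ?sqr_ge0// !sqrf_eq0; apply/negP => /andP[/eqP x0 /eqP y0].
by apply: u0; rewrite x0 y0.
Qed.

Lemma dotp_gt0_ne0 u v : 0 < dotp u v -> u <> (0, 0).
Proof. by move=> + u0; rewrite u0 /dotp /= !mul0r addr0 ltxx. Qed.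

(** The sum of two such angles is less than [pi] in absolute value, hence it
    differs from the third one by less than a full turn. *)
Lemma parg_cocycle u v w : 0 < dotp u v -> 0 < dotp v w -> 0 < dotp u w ->
  parg u v + parg v w = parg u w.
Proof.
move=> uv vw uw.
have [a ua] := angle_of_exists (dotp_gt0_ne0 uv).
have va := angle_of_parg ua uv.
have wa := angle_of_parg va vw.
apply: (addrI a); rewrite addrA; apply: angle_of_pargP => //.
have := parg_bound u v; have := parg_bound v w; rewrite -addrA addrAC subrr add0r.
have := ler_normD (parg u v) (parg v w); have := @pi_gt0 R; lra.
Qed.

End Angles.

(** * Squares, clamped parameters and uniformity *)

Section Topology.
Context {R : realType}.
Implicit Types (u v w z : R * R) (e r s t : R).

(** Open squares are described by four linear inequalities so that linear
    arithmetic applies to them directly. *)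
Definition close e z w : Prop :=
  [/\ z.1 - e < w.1, w.1 < z.1 + e, z.2 - e < w.2 & w.2 < z.2 + e].

Lemma nbhs_closeP z (P : set (R * R)) :
  nbhs z P <-> exists2 e, 0 < e & forall w, close e z w -> P w.
Proof.
split=> [/nbhs_ballP[e /= e0 h]|[e e0 h]].
  exists e => // w [h1 h2 h3 h4]; apply: h; split => /=;
    rewrite -ball_normE /= ltr_distl; apply/andP; split; lra.
apply/nbhs_ballP; exists e => // w [] /=; rewrite -!ball_normE /= !ltr_distl.
by move=> /andP[h1 h2] /andP[h3 h4]; apply: h; split; lra.
Qed.

Lemma near_close z e : 0 < e -> \forall w \near z, close e z w.
Proof. by move=> e0; apply/nbhs_closeP; exists e. Qed.

Lemma close_refl e z : 0 < e -> close e z z.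
Proof. by move=> e0; split; lra. Qed.

Lemma close_sym e z w : close e z w -> close e w z.
Proof. by move=> [? ? ? ?]; split; lra. Qed.

Lemma close_le e e' z w : e <= e' -> close e z w -> close e' z w.
Proof. by move=> ? [? ? ? ?]; split; lra. Qed.

Lemma close_trans e e' z w x : close e z w -> close e' w x -> close (e + e') z x.
Proof. by move=> [? ? ? ?] [? ? ? ?]; split; lra. Qed.

Lemma close_sub e e' z w x y : close e z w -> close e' x y ->
  close (e + e') (z - x) (w - y).
Proof. by move=> [? ? ? ?] [? ? ? ?]; split => /=; lra. Qed.

Lemma continuous_closeP (T : topologicalType) (f : T -> R * R) x :
  {for x, continuous f} <->
  forall e, 0 < e -> \forall y \near x, close e (f x) (f y).
Proof.
split=> [fc e e0|h].
  exact: (fc _ (near_close (f x) e0)).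
move=> U /nbhs_closeP[e e0 eU].
by apply: filterS (h e e0) => y; exact: eU.
Qed.

Lemma continuous_plane (T : topologicalType) (f g : T -> R) :
  continuous f -> continuous g -> continuous (fun x => (f x, g x)).
Proof. by move=> fc gc x; exact: (cvg_pair (fc x) (gc x)). Qed.

Lemma continuous_fst (T : topologicalType) (f : T -> R * R) :
  continuous f -> continuous (fun x => (f x).1).
Proof. by move=> fc x; apply: (continuous_comp (fc x)); exact: cvg_fst. Qed.

Lemma continuous_snd (T : topologicalType) (f : T -> R * R) :
  continuous f -> continuous (fun x => (f x).2).
Proof. by move=> fc x; apply: (continuous_comp (fc x)); exact: cvg_snd. Qed.

(** The retraction of the line onto the unit interval, written without case
    distinction so that its continuity is immediate. *)
Definition clamp t : R := (`|t| - `|t - 1| + 1) / 2.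

Lemma clamp_itv t : 0 <= clamp t <= 1.
Proof.
rewrite /clamp.
have [t0|t0] := ltP t 0.
  rewrite (ltr0_norm t0) ltr0_norm; last lra.
  by apply/andP; split; lra.
have [t1|t1] := ltP (t - 1) 0.
  rewrite (ger0_norm t0) ltr0_norm; last lra.
  by apply/andP; split; lra.
rewrite !ger0_norm//; by apply/andP; split; lra.
Qed.

Lemma clamp_id t : 0 <= t <= 1 -> clamp t = t.
Proof.
move=> /andP[t0 t1]; rewrite /clamp ger0_norm// ler0_norm; last lra.
by field.
Qed.

Lemma clamp_le0 t : t <= 0 -> clamp t = 0.
Proof. by move=> t0; rewrite /clamp !ler0_norm//; lra. Qed.

Lemma clamp_ge1 t : 1 <= t -> clamp t = 1.
Proof. by move=> t0; rewrite /clamp !ger0_norm//; lra. Qed.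

Lemma clamp0 : clamp 0 = 0. Proof. exact: clamp_le0. Qed.
Lemma clamp1 : clamp 1 = 1. Proof. exact: clamp_ge1. Qed.
Lemma clampK t : clamp (clamp t) = clamp t.
Proof. exact: clamp_id (clamp_itv t). Qed.

Lemma continuous_clamp : continuous clamp.
Proof.
move=> t; rewrite /clamp; apply: cvgM; last exact: cvg_cst.
apply: cvgD; last exact: cvg_cst.
apply: cvgB; first exact: norm_continuous.
apply: (@continuous_comp _ _ _ (fun t => t - 1) (fun x => `|x|)); last exact: norm_continuous.
by apply: cvgB; [exact: cvg_id|exact: cvg_cst].
Qed.

(** Paths are handled as total continuous functions that are constant before
    [0] and after [1]; this avoids subspace topologies. *)
Definition curve (T : topologicalType) (c : R -> T) :=
  continuous c /\ forall t, c t = c (clamp t).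

Lemma curve_clamp (T : topologicalType) (c : R -> T) :
  {within `[0, 1], continuous c} -> curve (c \o clamp).
Proof.
move=> cc; split; last by move=> t /=; rewrite clampK.
have h : continuous (fun t => (exist (fun x => x \in `[0, 1]%classic) (clamp t) (mem_set (clamp_itv t)) : `[0%R, 1%R]%classic)).
  by apply: continuous_comp_initial; exact: continuous_clamp.
move/subspace_sigL_continuousP : cc => cc.
by move=> t; exact: (continuous_comp (h t) (cc _)).
Qed.

(** A property depending monotonically on a scale, which holds locally at some
    scale, holds on a compact set at a single scale. *)
Lemma compact_unif (T : topologicalType) (K : set T) (Q : R -> T -> Prop) :
  compact K -> (forall e e' x, 0 < e' -> e' <= e -> Q e x -> Q e' x) ->
  (forall x, K x -> exists2 e, 0 < e & \forall y \near x, Q e y) ->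
  exists2 e, 0 < e & forall x, K x -> Q e x.
Proof.
move=> /compact_near_coveringP cK mono loc.
have := cK R 0^'+ Q _; case.
  move=> x /loc[e e0 he]; near=> y r => /=.
  apply: (mono e); [by near: r; exact: nbhs_right_gt| |by near: y].
  by near: r; exact: nbhs_right_le.
move=> e /= e0 h; exists (e / 2); first lra.
apply: (h (e / 2)); rewrite /=; last lra.
rewrite sub0r normrN gtr0_norm; lra.
Unshelve. all: by end_near. Qed.

(** The function takes its values in the multiples of [2 * pi], and its image
    is an interval. *)
Lemma connected_cos1_const (T : topologicalType) (C : set T) (h : T -> R) :
  connected C -> {within C, continuous h} ->
  (forall x, C x -> cos (h x) = 1) -> forall x y, C x -> C y -> h x = h y.
Proof.
move=> cC hc h1.
have /connected_intervalP itv := connected_continuous_connected cC hc.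
have key x y : C x -> C y -> ~~ (h x < h y).
  move=> Cx Cy; apply/negP => xy.
  pose v := Num.min (h y) (h x + pi).
  have xv : h x < v by rewrite lt_min xy ltrDl pi_gt0.
  have vy : v <= h y by rewrite ge_min lexx.
  have vp : v <= h x + pi by rewrite ge_min lexx orbT.
  have [z Cz zv] : [set h x | x in C] v.
    by apply: (itv (h x) (h y)); [by exists x|by exists y|rewrite (ltW xv)].
  have s0 a : cos a = 1 :> R -> sin a = 0.
    move=> ca; apply/eqP; rewrite -sqrf_eq0 sin2cos2 ca expr1n subrr; exact/eqP.
  have cz := h1 _ Cz; have cx := h1 _ Cx.
  have : cos (v - h x) = 1.
    by rewrite -zv cosB cz cx (s0 _ cz) mul0r addr0 mulr1.
  move/cos_eq1_lt2pi => e; have := @pi_gt0 R => p0.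
  suff : v - h x = 0 by lra.
  by apply: e; rewrite gtr0_norm; lra.
move=> x y Cx Cy; apply/eqP; rewrite eq_le !leNgt.
by rewrite !key.
Qed.

Lemma connected_setTR : connected (setT : set R).
Proof. by apply/connected_intervalP => x y _ _ z _. Qed.

Lemma continuous_dotp (T : topologicalType) (f g : T -> R * R) x :
  {for x, continuous f} -> {for x, continuous g} ->
  {for x, continuous (fun y => dotp (f y) (g y))}.
Proof.
move=> fc gc; rewrite /dotp; apply: cvgD; apply: cvgM.
- exact: (continuous_comp fc (@cvg_fst _ _ _ _ _)).
- exact: (continuous_comp gc (@cvg_fst _ _ _ _ _)).
- exact: (continuous_comp fc (@cvg_snd _ _ _ _ _)).
- exact: (continuous_comp gc (@cvg_snd _ _ _ _ _)).
Qed.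

Lemma continuous_parg (T : topologicalType) (f g : T -> R * R) x :
  {for x, continuous f} -> {for x, continuous g} -> 0 < dotp (f x) (g x) ->
  {for x, continuous (fun y => parg (f y) (g y))}.
Proof.
move=> fc gc d0; rewrite /parg.
apply: (@continuous_comp _ _ _ (fun y => crossp (f y) (g y) / dotp (f y) (g y)) atan);
  last exact: continuous_atan.
apply: cvgM; last first.
  by apply: cvgV; [rewrite gt_eqF|exact: continuous_dotp].
rewrite /crossp; apply: cvgB; apply: cvgM.
- exact: (continuous_comp fc (@cvg_fst _ _ _ _ _)).
- exact: (continuous_comp gc (@cvg_snd _ _ _ _ _)).
- exact: (continuous_comp fc (@cvg_snd _ _ _ _ _)).
- exact: (continuous_comp gc (@cvg_fst _ _ _ _ _)).
Qed.

(** Vectors in a small square away from the origin lie in a half plane as seen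
    from each other: one coordinate of [v] dominates the size of the square. *)
Lemma dotp_gt0_far rho v w z : 0 < rho -> ~ close rho (0, 0) v ->
  close (rho / 4) v w -> close (rho / 4) v z -> 0 < dotp w z.
Proof.
case: v w z => [a b] [c d] [x y] rho0; rewrite /close /dotp /=.
move=> nc [h1 h2 h3 h4] [g1 g2 g3 g4].
have small (p q r : R) : p - rho / 4 < q -> q < p + rho / 4 ->
  p - rho / 4 < r -> r < p + rho / 4 -> - (rho ^+ 2 / 4) <= q * r.
  move=> *; have [p1|p1] := leP (rho / 4) p; first by nra.
  have [p2|p2] := leP p (- (rho / 4)); by nra.
have big (p q r : R) : (p <= - rho \/ rho <= p) -> p - rho / 4 < q -> q < p + rho / 4 ->
  p - rho / 4 < r -> r < p + rho / 4 -> rho ^+ 2 / 4 < q * r.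
  by move=> [p1|p1] *; nra.
have [ha|ha] : (a <= - rho \/ rho <= a) \/ (b <= - rho \/ rho <= b).
  have [a1|a1] := leP a (- rho); first by left; left.
  have [a2|a2] := leP rho a; first by left; right.
  have [b1|b1] := leP b (- rho); first by right; left.
  have [b2|b2] := leP rho b; first by right; right.
  by case: nc; split; lra.
- have := small b d y h3 h4 g3 g4; have := big a c x ha h1 h2 g1 g2; lra.
- have := small a c x h1 h2 g1 g2; have := big b d y ha h3 h4 g3 g4; lra.
Qed.

Lemma far_ne0 v : v <> (0, 0) -> exists2 e, 0 < e & ~ close e (0, 0) v.
Proof.
case: v => a b v0.
have [a0|a0] := eqVneq a 0; last first.
  exists `|a|; rewrite ?normr_gt0// => -[] /=; rewrite ?add0r ?sub0r => h1 h2 _ _.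
  have : `|a| < `|a| by rewrite {1}ltr_norml h1.
  by rewrite ltxx.
have [b0|b0] := eqVneq b 0; first by case: v0; rewrite a0 b0.
exists `|b|; rewrite ?normr_gt0// => -[] /=; rewrite ?add0r ?sub0r => _ _ h1 h2.
have : `|b| < `|b| by rewrite {1}ltr_norml h1.
by rewrite ltxx.
Qed.

End Topology.

(** * Continuous determinations of the angle *)

Section Lifting.
Context {R : realType}.
Implicit Types (u v w z : R * R) (e r s t : R).

Lemma curve_comp (T U : topologicalType) (g : T -> U) (c : R -> T) :
  continuous g -> curve c -> curve (fun t => g (c t)).
Proof.
move=> gc [cc cE]; split; last by move=> t; rewrite cE.
by move=> t; exact: (continuous_comp (cc t) (gc _)).
Qed.

Lemma curve_pair (a b : R -> R) : curve a -> curve b -> curve (fun t => (a t, b t)).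
Proof.
move=> [ac aE] [bc bE]; split; last by move=> t; rewrite aE bE.
exact: continuous_plane.
Qed.

Lemma curveD (a b : R -> R) : curve a -> curve b -> curve (fun t => a t + b t).
Proof.
move=> [ac aE] [bc bE]; split; last by move=> t; rewrite aE bE.
by move=> t; apply: cvgD; [exact: ac|exact: bc].
Qed.

Lemma curve_fst (c : R -> R * R) : curve c -> curve (fun t => (c t).1).
Proof. by move=> cc; apply: (curve_comp _ cc) => x; exact: cvg_fst. Qed.

Lemma curve_snd (c : R -> R * R) : curve c -> curve (fun t => (c t).2).
Proof. by move=> cc; apply: (curve_comp _ cc) => x; exact: cvg_snd. Qed.

Lemma curve_cst (T : topologicalType) (x : T) : curve (fun _ : R => x).
Proof. by split=> // t; exact: cvg_cst. Qed.

Lemma curve_shift (c : R -> R * R) y : curve c ->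
  curve (fun t => c t - y).
Proof.
move=> cc.
have -> : (fun t => c t - y) = (fun t => ((c t).1 + - y.1, (c t).2 + - y.2)).
  by apply/funext => t; case: (c t) y => [? ?] [? ?].
by apply: curve_pair; apply: curveD; (try exact: curve_fst); (try exact: curve_snd); exact: curve_cst.
Qed.

Lemma continuous_near_eq (T : topologicalType) (f g : T -> R) x :
  (\forall y \near x, f y = g y) -> {for x, continuous g} -> {for x, continuous f}.
Proof.
move=> fg gc; rewrite /prop_for /continuous_at (nbhs_singleton fg).
apply: cvg_trans gc; apply: near_eq_cvg.
by apply: filterS fg => y.
Qed.

(** Adding a small angle carries a determination of the angle along one curve to
    a determination along a nearby curve. *)
Lemma lift_close (c c' : R -> R * R) (th : R -> R) :
  curve c -> curve c' -> curve th -> (forall t, 0 < dotp (c t) (c' t)) ->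
  (forall t, angle_of (c t) (th t)) ->
  curve (fun t => th t + parg (c t) (c' t)) /\
  forall t, angle_of (c' t) (th t + parg (c t) (c' t)).
Proof.
move=> [cc cE] [cc' cE'] hth d0 ang; split; last first.
  by move=> t; exact: angle_of_parg.
apply: curveD => //; split; last by move=> t; rewrite cE cE'.
by move=> t; apply: continuous_parg => //; [exact: cc|exact: cc'].
Qed.

(** The difference of two determinations is a continuous function with values
    in the multiples of [2 * pi]. *)
Lemma lift_diff (c : R -> R * R) (th th' : R -> R) : curve th -> curve th' ->
  (forall t, angle_of (c t) (th t)) -> (forall t, angle_of (c t) (th' t)) ->
  forall s t, th s - th' s = th t - th' t.
Proof.
move=> [tc _] [tc' _] h h' s t.
apply: (@connected_cos1_const _ _ setT (fun t => th t - th' t)) => //.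
- exact: connected_setTR.
- by apply: continuous_subspaceT => x; apply: cvgB; [exact: tc|exact: tc'].
- by move=> x _; exact: angle_of_cosB (h x) (h' x).
Qed.

Lemma itv_unif (Q : R -> R -> Prop) :
  (forall e e' x, 0 < e' -> e' <= e -> Q e x -> Q e' x) ->
  (forall x : R, 0 <= x <= 1 -> exists2 e, 0 < e & \forall y \near x, Q e y) ->
  exists2 e, 0 < e & forall x, 0 <= x <= 1 -> Q e x.
Proof.
move=> mono loc.
have cI : compact [set x : R | 0 <= x <= 1].
  have -> : [set x : R | 0 <= x <= 1] = `[0, 1]%classic by apply/seteqP; split => x /=; rewrite in_itv.
  exact: segment_compact.
exact: (compact_unif cI mono loc).
Qed.

Lemma curve_dotp_unif (c : R -> R * R) : curve c -> (forall t, c t <> (0, 0)) ->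
  exists2 e, 0 < e & forall s t, 0 <= s <= 1 -> `|t - s| < e -> 0 < dotp (c s) (c t).
Proof.
move=> [cc _] c0.
have [||e e0 h] := @itv_unif
  (fun e s => forall t, `|t - s| < e -> 0 < dotp (c s) (c t)).
- by move=> e e' x e'0 ee' h t te; apply: h; exact: lt_le_trans te ee'.
- move=> x _; have [r r0 far] := far_ne0 (c0 x).
  have /continuous_closeP/(_ (r / 4)) := cc x.
  rewrite divr_gt0// => /(_ isT) /nbhs_ballP[d /= d0 hd].
  exists (d / 2); first lra.
  apply/nbhs_ballP; exists (d / 2); first by rewrite /=; lra.
  move=> y xy t ty.
  move: xy; rewrite -ball_normE /= => xy.
  apply: (dotp_gt0_far r0 far); apply: hd; rewrite -ball_normE /=.
    lra.
  have : `|x - t| <= `|x - y| + `|y - t| by rewrite (le_trans _ (ler_normD _ _))// addrA subrK.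
  rewrite (distrC y t); lra.
by exists e => // s t s01; apply: h.
Qed.

(** Cut the unit interval into [N] pieces on which the direction varies by less
    than a right angle, and add the small angles between consecutive curves
    [t |-> c (n / N * t)], starting from a constant curve. *)
Lemma curve_lift (c : R -> R * R) a : curve c -> (forall t, c t <> (0, 0)) ->
  angle_of (c 0) a ->
  exists th : R -> R, [/\ curve th, forall t, angle_of (c t) (th t) & th 0 = a].
Proof.
move=> hc c0 ca; have [e e0 he] := curve_dotp_unif hc c0.
pose N := (Num.truncn e^-1).+1.
have N0 : 0 < N%:R :> R by rewrite ltr0n.
have Ne : N%:R^-1 < e.
  rewrite -[e]invrK ltf_pV2 ?posrE ?invr_gt0//.
  by rewrite truncnS_gt.
have curven x : curve (fun t => c (x * clamp t)).
  have [cc cE] := hc; split; last by move=> t; rewrite clampK.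
  move=> t; apply: (@continuous_comp _ _ _ (fun t => x * clamp t) c); last exact: cc.
  by apply: cvgM; [exact: cvg_cst|exact: continuous_clamp].
have step n : (n <= N)%N -> exists th : R -> R,
    [/\ curve th, forall t, angle_of (c (n%:R / N%:R * clamp t)) (th t) & th 0 = a].
  elim: n => [_|n IH nN].
    exists (fun=> a); split => //; first exact: curve_cst.
    by move=> t; rewrite !mul0r.
  have [th [h1 h2 h3]] := IH (ltnW nN).
  have d0 t : 0 < dotp (c (n%:R / N%:R * clamp t)) (c (n.+1%:R / N%:R * clamp t)).
    have /andP[t0 t1] := clamp_itv t.
    have n1 : n%:R / N%:R <= 1 :> R by rewrite ler_pdivrMr// mul1r ler_nat ltnW.
    apply: he.
      have n0 : 0 <= n%:R / N%:R :> R := divr_ge0 (ler0n _ _) (ler0n _ _).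
      by rewrite (mulr_ge0 n0 t0) (mulr_ile1 n0 t0 n1 t1).
    rewrite -mulrBl -mulrBl -natrB// subSnn mul1r.
    have N1 : 0 <= N%:R^-1 :> R by rewrite invr_ge0 ler0n.
    rewrite (ger0_norm (mulr_ge0 N1 t0)).
    apply: le_lt_trans Ne; exact: ler_piMr.
  have [g1 g2] := lift_close (curven _) (curven _) h1 d0 h2.
  eexists; split; [exact: g1|exact: g2|].
  by rewrite /= clamp0 !mulr0 parg_self addr0.
have [th [h1 h2 h3]] := step N (leqnn N).
exists th; split => // t; rewrite (hc.2 t) -[clamp t]mul1r -(@divff _ (N%:R : R)) ?gt_eqF//.
Qed.

(** The angle at [z] is obtained by continuation along the ray from the origin;
    nearby rays stay uniformly close, so [lift_close] compares their lifts. *)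
Lemma plane_lift (u : R * R -> R * R) : continuous u -> (forall z, u z <> (0, 0)) ->
  exists th : R * R -> R, continuous th /\ forall z, angle_of (u z) (th z).
Proof.
move=> uc u0; have [a ha] := angle_of_exists (u0 (0, 0)).
pose ray z t := u (clamp t * z.1, clamp t * z.2).
have rayc z : curve (ray z).
  apply: (curve_comp uc); split; last by move=> t; rewrite clampK.
  apply: continuous_plane => t; apply: cvgM; (try exact: cvg_cst); exact: continuous_clamp.
have ex z : exists th : R -> R, [/\ curve th, forall t, angle_of (ray z t) (th t) & th 0 = a].
  apply: curve_lift; [exact: rayc|by move=> t; exact: u0|].
  by rewrite /ray clamp0 !mul0r.
have {ex}[Th hTh] := choice ex.
have ray1 z : ray z 1 = u z by rewrite /ray clamp1 !mul1r; case: z.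
have near1 z : \forall w \near z, Th w 1 = Th z 1 + parg (u z) (u w) /\ 0 < dotp (u z) (u w).
  have [||e e0 h] := @itv_unif
    (fun e t => forall w, close e z w -> 0 < dotp (ray z t) (ray w t)).
  - move=> e e' t e'0 ee' h w [*]; apply: h; split; lra.
  - move=> t0 _; have [r r0 far] := far_ne0 (u0 (clamp t0 * z.1, clamp t0 * z.2)).
    pose G (p : R * (R * R)) := u (clamp p.1 * p.2.1, clamp p.1 * p.2.2).
    have Gc : continuous G.
      have c1 : continuous (fun p : R * (R * R) => clamp p.1).
        by move=> p; apply: (@continuous_comp _ _ _ fst clamp); [exact: cvg_fst|exact: continuous_clamp].
      have c2 : continuous (fun p : R * (R * R) => p.2) by move=> p; exact: cvg_snd.
      move=> p; apply: (@continuous_comp _ _ _ (fun p : R * (R * R) => (clamp p.1 * p.2.1, clamp p.1 * p.2.2)) u); last exact: uc.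
      apply: continuous_plane => q; apply: cvgM; try exact: c1.
        exact: (continuous_fst c2).
      exact: (continuous_snd c2).
    have /continuous_closeP/(_ (r / 4)) := Gc (t0, z).
    rewrite divr_gt0// => /(_ isT) [[A B] /= [nA nB] AB].
    move: nB => /nbhs_closeP[e e0 eB].
    exists e => //; apply: filterS nA => t At w zw.
    apply: (dotp_gt0_far r0 far); apply: (AB (t, _)); split => //=; apply: eB => //.
    exact: close_refl.
  have /near_close/filterS := e0; move/(_ z); apply => w zw.
  have d0 t : 0 < dotp (ray z t) (ray w t).
    rewrite (rayc z).2 (rayc w).2; apply: h => //.
    exact: clamp_itv.
  split; last by rewrite -!ray1.
  have [th1 th2 th3] := hTh z; have [th1' th2' th3'] := hTh w.
  have [g1 g2] := lift_close (rayc z) (rayc w) th1 d0 th2.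
  have := lift_diff th1' g1 th2' g2 1 0.
  rewrite th3 th3' /ray clamp0 clamp1 !mul0r parg_self addr0 subrr !mul1r -!surjective_pairing.
  by move=> /eqP; rewrite subr_eq0 => /eqP.
exists (fun z => Th z 1); split; last first.
  by move=> z; have [_ h _] := hTh z; have := h 1; rewrite ray1.
move=> z; apply: (@continuous_near_eq _ _ (fun w => Th z 1 + parg (u z) (u w))).
  by apply: filterS (near1 z) => w [].
apply: (@continuousD _ _ _ (fun=> Th z 1)); first exact: cvg_cst.
apply: (@continuous_parg _ _ (fun=> u z)); [exact: cvg_cst|exact: uc|].
exact: dotp_gt0_self.
Qed.

End Lifting.

Section AngleRanges.
Context {R : realType}.
Implicit Types (u v w z : R * R) (e r s t a b : R) (c : R -> R * R) (th : R -> R).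

Lemma ivt_line (h : R -> R) s t (v : R) : continuous h -> h s <= v <= h t -> exists r, h r = v.
Proof.
move=> hc hv.
have hw : {within setT, continuous h} by exact: continuous_subspaceT.
have /connected_intervalP itv := connected_continuous_connected (@connected_setTR R) hw.
by have [r _ rv] := itv (h s) (h t) (ex_intro2 _ _ s I erefl) (ex_intro2 _ _ t I erefl) v hv; exists r.
Qed.

(** An angle starting in the upper half plane cannot cross the vertical directions
    while the vector keeps pointing to the right. *)
Lemma lift_east c th : continuous th -> (forall t, angle_of (c t) (th t)) ->
  (forall t, 0 < (c t).1) -> 0 < th 1 < pi -> `|th 0| < pi / 2.
Proof.
move=> tc ang pos /andP[t1 t1'].
have p0 := @pi_gt0 R.
have h1 : `|th 1 - 0| < pi / 2.
  apply: (angle_of_near (@angle_of_east R) (ang 1)).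
    by rewrite /dotp /= mul1r mul0r addr0.
  by rewrite subr0 gtr0_norm//; lra.
move: h1; rewrite subr0 gtr0_norm// => h1.
have nocos t : cos (th t) != 0.
  apply/eqP => c0; have := pos t; have [r r0 ->] := ang t.
  by rewrite /= c0 mulr0 ltxx.
rewrite ltr_norml; apply/andP; split; rewrite ltNge; apply/negP => h.
- have [|r rv] := @ivt_line th 0 1 (- (pi / 2)) tc.
    by apply/andP; split; lra.
  by have := nocos r; rewrite rv cosN cos_pihalf eqxx.
- have [|r rv] := @ivt_line th 1 0 (pi / 2) tc.
    by apply/andP; split; lra.
  by have := nocos r; rewrite rv cos_pihalf eqxx.
Qed.

Lemma lift_west c th : continuous th -> (forall t, angle_of (c t) (th t)) ->
  (forall t, (c t).1 < 0) -> 0 < th 1 < pi -> `|th 0 - pi| < pi / 2.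
Proof.
move=> tc ang pos /andP[t1 t1'].
have p0 := @pi_gt0 R.
have h1 : `|th 1 - pi| < pi / 2.
  apply: (angle_of_near (@angle_of_west R) (ang 1)).
    by rewrite /dotp /= mul0r addr0; have := pos 1; lra.
  by rewrite ltr0_norm//; lra.
move: h1; rewrite ltr0_norm; last lra; move=> h1.
have nocos t : cos (th t) != 0.
  apply/eqP => c0; have := pos t; have [r r0 ->] := ang t.
  by rewrite /= c0 mulr0 ltxx.
rewrite ltr_norml; apply/andP; split; rewrite ltNge; apply/negP => h.
- have [|r rv] := @ivt_line th 0 1 (pi / 2) tc.
    by apply/andP; split; lra.
  by have := nocos r; rewrite rv cos_pihalf eqxx.
- have [|r rv] := @ivt_line th 1 0 (pi / 2 + pi) tc.
    by apply/andP; split; lra.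
  by have := nocos r; rewrite rv cosDpi cos_pihalf oppr0 eqxx.
Qed.

Lemma lift_upper c th : continuous th -> (forall t, angle_of (c t) (th t)) ->
  (forall t, 0 <= (c t).2) -> 0 < th 1 < pi -> 0 <= th 0 <= pi.
Proof.
move=> tc ang pos /andP[t1 t1'].
have p0 := @pi_gt0 R.
have nosin t : 0 <= sin (th t).
  have := pos t; have [r r0 ->] := ang t; rewrite /= pmulr_rge0//.
have neg (x : R) : 0 < x < pi -> sin (- x) < 0.
  by move=> /sin_gt0_pi; rewrite sinN; lra.
apply/andP; split; rewrite leNgt; apply/negP => h.
- pose v := Num.max (th 0) (- (pi / 2)).
  have v1 : th 0 <= v by rewrite le_max lexx.
  have v2 : - (pi / 2) <= v by rewrite le_max lexx orbT.
  have v3 : v < 0 by rewrite gt_max h; lra.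
  have [|r rv] := @ivt_line th 0 1 v tc; first by apply/andP; split; lra.
  have := nosin r; rewrite rv -[v]opprK leNgt neg//; apply/andP; split; lra.
- pose v := Num.min (th 0) (pi + pi / 2).
  have v1 : v <= th 0 by rewrite ge_min lexx.
  have v2 : v <= pi + pi / 2 by rewrite ge_min lexx orbT.
  have v3 : pi < v by rewrite lt_min h; lra.
  have [|r rv] := @ivt_line th 1 0 v tc; first by apply/andP; split; lra.
  have := nosin r; rewrite rv; have -> : v = (v - pi) + pi by lra.
  rewrite sinDpi oppr_ge0 leNgt sin_gt0_pi//; apply/andP; split; lra.
Qed.

Lemma angle_of_add v a b : cos b = 1 -> angle_of v a -> angle_of v (a + b).
Proof.
move=> cb; have sb : sin b = 0.
  by apply/eqP; rewrite -sqrf_eq0 sin2cos2 cb expr1n subrr.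
by rewrite /angle_of cosD sinD cb sb !mulr0 !mulr1 subr0 addr0.
Qed.

Lemma angle_north v : 0 < v.2 -> exists2 a, angle_of v a & 0 < a < pi.
Proof.
move=> v0; exists (pi / 2 + parg (0, 1) v).
  by apply: angle_of_parg (@angle_of_north R) _; rewrite /dotp /= mul0r mul1r add0r.
have := parg_bound (0, 1) v; rewrite ltr_norml => /andP[h1 h2].
by apply/andP; split; lra.
Qed.

Lemma angle_north_stay v a : 0 < v.2 -> angle_of v a -> `|a - pi / 2| < pi + pi / 2 ->
  0 < a < pi.
Proof.
move=> v0 va ha.
have : `|a - pi / 2| < pi / 2.
  by apply: angle_of_near (@angle_of_north R) va _ ha; rewrite /dotp /= mul0r mul1r add0r.
by rewrite ltr_norml => /andP[h1 h2]; apply/andP; split; lra.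
Qed.

End AngleRanges.

Section Concatenation.
Context {R : realType} {V : normedModType R}.
Implicit Types (a b : R -> V).

(** Concatenation in a vector space.  Since [a] and [b] are constant outside the
    unit interval, the sum always has one constant term, which the subtraction
    of [a 1] removes when [a 1 = b 0]; continuity needs no gluing argument. *)
Definition ccat a b : R -> V := fun t => a (clamp (2 * t)) + b (clamp (2 * t - 1)) - a 1.

Lemma ccat_l a b t : a 1 = b 0 -> t <= 2^-1 -> ccat a b t = a (clamp (2 * t)).
Proof.
move=> ab t2; rewrite /ccat (@clamp_le0 _ (2 * t - 1)); last lra.
by rewrite ab addrK.
Qed.

Lemma ccat_r a b t : 2^-1 <= t -> ccat a b t = b (clamp (2 * t - 1)).
Proof.
move=> t2; rewrite /ccat (@clamp_ge1 _ (2 * t)); last lra.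
by rewrite addrAC subrr add0r.
Qed.

Lemma ccat0 a b : a 1 = b 0 -> ccat a b 0 = a 0.
Proof. by move=> ab; rewrite ccat_l ?mulr0 ?clamp0 ?invr_ge0. Qed.

Lemma ccat1 a b : ccat a b 1 = b 1.
Proof. by rewrite ccat_r ?mulr1; [rewrite clamp_ge1//; lra|lra]. Qed.

Lemma ccat_all (P : V -> Prop) a b : a 1 = b 0 ->
  (forall t, P (a t)) -> (forall t, P (b t)) -> forall t, P (ccat a b t).
Proof.
move=> ab Pa Pb t; have [t2|t2] := leP t 2^-1.
  by rewrite ccat_l.
by rewrite ccat_r ?ltW.
Qed.

Lemma curve_ccat a b : curve a -> curve b -> curve (ccat a b).
Proof.
move=> [ac aE] [bc bE]; split; last first.
  move=> t; rewrite /ccat.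
  have [t0|t0] := leP t 0.
    by rewrite (clamp_le0 t0) mulr0 !clamp_le0//; lra.
  have [t1|t1] := leP 1 t.
    by rewrite (clamp_ge1 t1) mulr1 !clamp_ge1//; lra.
  by rewrite (@clamp_id _ t)// !ltW.
have lin (x y : R) : continuous (fun t : R => clamp (x * t - y)).
  move=> t; apply: (@continuous_comp _ _ _ (fun t => x * t - y) clamp); last exact: continuous_clamp.
  apply: cvgB; last exact: cvg_cst.
  by apply: cvgM; [exact: cvg_cst|exact: cvg_id].
move=> t; apply: cvgB; last exact: cvg_cst.
apply: cvgD.
- have := lin 2 0; under eq_fun do rewrite subr0.
  by move=> h; exact: (continuous_comp (h t) (ac _)).
- exact: (continuous_comp (lin 2 1 t) (bc _)).
Qed.

End Concatenation.

(** * Barriers and the region above them *)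

Section Barrier.
Context {R : realType}.
Implicit Types (u v w y z : R * R) (e r s t a b : R) (c : R -> R * R) (th : R -> R).
Implicit Types (L C : set (R * R)).

(** What is retained of the preimage in the plane of an essential locally
    connected continuum of the annulus: a closed set [L] invariant under the
    unit translation, lying at heights [lo] to [hi].
    [barrier_conn] expresses that its image in the annulus is connected,
    [barrier_ulc] that it is uniformly locally connected, and [barrier_sep]
    that it separates what is below it from what is above it. *)
Record barrier L (lo hi : R) : Prop := {
  barrier_closed : closed L ;
  barrier_succ : forall z, L z -> L (z.1 + 1, z.2) ;
  barrier_pred : forall z, L z -> L (z.1 - 1, z.2) ;
  barrier_lo : forall z, L z -> lo <= z.2 ;
  barrier_hi : forall z, L z -> z.2 <= hi ;
  barrier_lo_ex : exists2 z, L z & z.2 = lo ;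
  barrier_hi_ex : exists2 z, L z & z.2 = hi ;
  barrier_conn : forall P : set (R * R),
    (forall z, L z -> P z -> P (z.1 + 1, z.2)) ->
    (forall z, L z -> P z -> P (z.1 - 1, z.2)) ->
    (forall z, L z -> exists2 e, 0 < e &
       forall w, L w -> close e z w -> P z <-> P w) ->
    (exists2 z, L z & P z) -> forall z, L z -> P z ;
  barrier_ulc : forall e, 0 < e -> exists2 r, 0 < r &
    forall v w, L v -> L w -> close r v w ->
    exists C, [/\ connected C, C `<=` L, C v, C w & forall y, C y -> close e v y] ;
  barrier_sep : forall c, curve c -> (forall t, ~ L (c t)) ->
    (c 0).2 < lo -> hi < (c 1).2 -> False }.

Definition seg z w t : R * R := (z.1 + clamp t * (w.1 - z.1), z.2 + clamp t * (w.2 - z.2)).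

Lemma seg0 z w : seg z w 0 = z.
Proof. by rewrite /seg clamp0 !mul0r !addr0; case: z. Qed.
Lemma seg1 z w : seg z w 1 = w.
Proof. by rewrite /seg clamp1 !mul1r ![_ + (_ - _)]addrC !subrK; case: w. Qed.

Lemma curve_seg z w : curve (seg z w).
Proof.
have h (x y : R) : curve (fun t => x + clamp t * y).
  split; last by move=> t; rewrite clampK.
  move=> t; apply: cvgD; first exact: cvg_cst.
  by apply: cvgM; [exact: continuous_clamp|exact: cvg_cst].
exact: curve_pair.
Qed.

Lemma seg_rev z w t : exists s, seg w z t = seg z w s.
Proof.
exists (1 - clamp t); rewrite /seg (@clamp_id _ (1 - clamp t)); first by congr pair; ring.
have /andP[t0 t1] := clamp_itv t; apply/andP; split; lra.
Qed.

Lemma seg_close e z w t : close e z w -> close e z (seg z w t).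
Proof.
move=> [h1 h2 h3 h4]; have /andP[t0 t1] := clamp_itv t.
by rewrite /seg; split => /=; nra.
Qed.

Definition up_path L hi z c : Prop :=
  [/\ curve c, forall t, ~ L (c t), c 0 = z & hi < (c 1).2].

Definition Up L hi z : Prop := exists c, up_path L hi z c.

(** The angle under which the start of [c] is seen from [y], when it is followed
    backwards from the end of [c], where it is an angle of the upper half plane. *)
Definition lifts_from c y a : Prop :=
  exists th, [/\ curve th, forall t, angle_of (c t - y) (th t), 0 < th 1 < pi & th 0 = a].

Definition view_angle L hi z y a : Prop :=
  exists2 c, up_path L hi z c & lifts_from c y a.

Lemma up_path_cat L hi z w c (a : R -> R * R) : curve a -> (forall t, ~ L (a t)) ->
  a 0 = w -> a 1 = z -> up_path L hi z c -> up_path L hi w (ccat a c).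
Proof.
move=> ac aL a0 a1 [cc cL c0 c1].
have ac1 : a 1 = c 0 by rewrite a1.
split; first exact: curve_ccat.
- exact: (ccat_all (P := fun z => ~ L z)).
- by rewrite ccat0.
- by rewrite ccat1.
Qed.

Lemma Up_seg L hi z w : Up L hi z -> (forall t, ~ L (seg z w t)) -> Up L hi w.
Proof.
move=> [c hc] zw; exists (ccat (seg w z) c).
apply: up_path_cat hc; [exact: curve_seg| |exact: seg0|exact: seg1].
by move=> t; have [s ->] := seg_rev z w t.
Qed.

Lemma Up_notin L hi z : Up L hi z -> ~ L z.
Proof. by move=> [c [_ cL <- _]]; exact: cL. Qed.

Lemma Up_high L hi z : (forall z, L z -> z.2 <= hi) -> hi < z.2 -> Up L hi z.
Proof.
move=> Lhi hz; exists (fun=> z); split=> //; first exact: curve_cst.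
by move=> _ /Lhi; lra.
Qed.

Lemma subnz u v : u <> v -> u - v <> (0, 0).
Proof. by move=> uv e; apply: uv; apply/eqP; rewrite -subr_eq0; exact/eqP. Qed.

Lemma lifts_from_exists L hi z c y : (forall z, L z -> z.2 <= hi) ->
  up_path L hi z c -> L y -> exists a, lifts_from c y a.
Proof.
move=> Lhi [cc cL _ c1] Ly.
have nz t : c t - y <> (0, 0) by apply: subnz => e; apply: (cL t); rewrite e.
have [a0 ha0] := angle_of_exists (nz 0).
have [th [h1 h2 h3]] := curve_lift (curve_shift y cc) nz ha0.
have [b hb b0] : exists2 b, angle_of (c 1 - y) b & 0 < b < pi.
  by apply: angle_north => /=; rewrite subr_gt0; have := Lhi _ Ly; lra.
exists (th 0 + (b - th 1)), (fun t => th t + (b - th 1)); split => //.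
- by apply: curveD => //; exact: curve_cst.
- by move=> t; apply: angle_of_add => //; exact: angle_of_cosB hb (h2 1).
- by rewrite addrC subrK.
Qed.

Lemma curve_avoid_unif L c : closed L -> curve c -> (forall t, ~ L (c t)) ->
  exists2 r, 0 < r & forall t y, L y -> ~ close r (c t) y.
Proof.
move=> Lcl [cc cE] cL.
have [||r r0 h] := @itv_unif R (fun e t => forall y, L y -> ~ close e (c t) y).
- move=> e e' x e'0 ee' h y Ly [*]; apply: (h y Ly); split; lra.
- move=> x _.
  have : nbhs (c x) (~` L) by apply: open_nbhs_nbhs; split; [exact: closed_openC|exact: cL].
  move=> /nbhs_closeP[e e0 he]; exists (e / 2); first lra.
  have /continuous_closeP/(_ (e / 2)) := cc x.
  rewrite divr_gt0// => /(_ isT); apply: filterS => t [h1 h2 h3 h4] y Ly [k1 k2 k3 k4].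
  apply: (he y _ Ly); split; lra.
exists r => // t; rewrite cE; apply: h; exact: clamp_itv.
Qed.

Lemma far_shift r u y : ~ close r u y -> ~ close r (0, 0) (u - y).
Proof. by move=> h [/= *]; apply: h; split; lra. Qed.

Lemma close_shift r u y y' : close r y y' -> close r (u - y) (u - y').
Proof. by move=> [*]; split => /=; lra. Qed.

(** The path stays at a positive distance from [L], so moving [y] slightly within
    [L] changes all angles by less than a right angle.  The endpoint remains
    higher than [y], so the normalisation at the end of the path is preserved. *)
Lemma lifts_from_near L hi z c : closed L -> (forall z, L z -> z.2 <= hi) ->
  up_path L hi z c ->
  exists2 r, 0 < r & forall y y', L y -> L y' -> close r y y' ->
    0 < dotp (z - y) (z - y') /\
    forall a, lifts_from c y a -> lifts_from c y' (a + parg (z - y) (z - y')).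
Proof.
move=> Lcl Lhi [cc cL c0 c1].
have [r r0 far] := curve_avoid_unif Lcl cc cL.
exists (r / 4); first lra.
move=> y y' Ly Ly' yy'.
have d0 t : 0 < dotp (c t - y) (c t - y').
  apply: (dotp_gt0_far r0 (far_shift (far t y Ly))).
    by apply: close_refl; lra.
  exact: close_shift.
split; first by rewrite -c0.
move=> a [th [h1 h2 h3 h4]].
have [g1 g2] := lift_close (curve_shift y cc) (curve_shift y' cc) h1 d0 h2.
exists (fun t => th t + parg (c t - y) (c t - y')); split => //; last by rewrite h4 c0.
apply: (angle_north_stay _ (g2 1)).
  by rewrite /= subr_gt0; have := Lhi _ Ly'; lra.
have := parg_bound (c 1 - y) (c 1 - y'); move: h3 => /andP[h3 h3'].
rewrite ltr_norml => /andP[k1 k2]; rewrite ltr_norml; apply/andP; split; lra.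
Qed.

Lemma barrier_shiftz L lo hi z (n : int) : barrier L lo hi -> L z ->
  L (z.1 + n%:~R, z.2).
Proof.
move=> bL Lz; elim: n => [|n|n].
- by rewrite addr0; case: z Lz.
- by move=> /(barrier_succ bL) /=; rewrite intS intrD -addrA [1 + _]addrC.
- move=> /(barrier_pred bL) /=; rewrite -addrA.
  by have -> : (- (n.+1)%:Z)%:~R = (- n%:Z)%:~R - 1 :> R by rewrite intS opprD intrD addrC.
Qed.

(** Otherwise the rest of the path would cross the barrier. *)
Lemma up_path_above L lo hi z c : barrier L lo hi -> up_path L hi z c ->
  forall t, lo <= (c t).2.
Proof.
move=> bL [[cc cE] cL _ c1] t; rewrite leNgt; apply/negP => ct.
pose g s : R := clamp t + clamp s * (1 - clamp t).
have gE s : c (g s) = (c \o g) s by [].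
apply: (barrier_sep bL (c := c \o g)).
- split; last by move=> s; rewrite /= /g clampK.
  move=> s; apply: continuous_comp; last exact: cc.
  apply: cvgD; first exact: cvg_cst.
  by apply: cvgM; [exact: continuous_clamp|exact: cvg_cst].
- by move=> s; exact: cL.
- by rewrite /= /g clamp0 mul0r addr0 -cE.
- by rewrite /= /g clamp1 mul1r addrC subrK.
Qed.

(** The central fact on views: the angle does not depend on the path to the top.
    The points [y] of [L] at which two given paths yield the same angle, together with all
    their translates, form a translation invariant set which is open and closed
    in [L].  It contains the lowest points of [L]: seen from there, both paths
    stay in the closed upper half plane, so that both angles lie between [0]
    and [pi]. *)
Lemma view_angle_uniq L lo hi z y a a' : barrier L lo hi -> L y ->
  view_angle L hi z y a -> view_angle L hi z y a' -> a = a'.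
Proof.
move=> bL Ly [c hc ca] [c' hc' ca'].
have Lcl := barrier_closed bL; have Lhi := barrier_hi bL.
pose good y := forall a a', lifts_from c y a -> lifts_from c' y a' -> a = a'.
(* All translates of [y] are considered at once, since [good] itself is not known
   to be invariant under translation. *)
suff : forall y, L y -> forall n : int, good (y.1 + n%:~R, y.2).
  move=> /(_ _ Ly 0); rewrite addr0 -surjective_pairing; exact.
move=> {y Ly a a' ca ca'}.
have [r1 r10 near1] := lifts_from_near Lcl Lhi hc.
have [r2 r20 near2] := lifts_from_near Lcl Lhi hc'.
have loc y y' : L y -> L y' -> close (Num.min r1 r2) y y' -> good y' -> good y.
  move=> Ly Ly' [h1 h2 h3 h4] gy' a a' ha ha'.
  have m1 : Num.min r1 r2 <= r1 by rewrite ge_min lexx.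
  have m2 : Num.min r1 r2 <= r2 by rewrite ge_min lexx orbT.
  have [_ k1] := near1 y y' Ly Ly' ltac:(split; lra).
  have [_ k2] := near2 y y' Ly Ly' ltac:(split; lra).
  have := gy' _ _ (k1 _ ha) (k2 _ ha').
  exact: addIr.
apply: (barrier_conn bL).
- move=> y Ly h n; have := h (n + 1) => /=.
  by rewrite intrD -addrA [1 + _]addrC.
- move=> y Ly h n; have := h (n - 1) => /=.
  by rewrite intrD -addrA [- 1 + _]addrC.
- move=> y Ly; exists (Num.min r1 r2); first by rewrite lt_min r10.
  move=> w Lw [h1 h2 h3 h4]; split=> h n.
    apply: loc (h n); [exact: barrier_shiftz bL _|exact: barrier_shiftz bL _|].
    split => /=; lra.
  apply: loc (h n); [exact: barrier_shiftz bL _|exact: barrier_shiftz bL _|].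
  split => /=; lra.
- have [y Ly ylo] := barrier_lo_ex bL.
  exists y => // n a a' [th [h1 h2 h3 <-]] [th' [g1 g2 g3 <-]].
  have /andP[t1 t2] := lift_upper h1.1 h2 (fun t => ltac:(rewrite /= subr_ge0 ylo; exact: up_path_above bL hc t)) h3.
  have /andP[t1' t2'] := lift_upper g1.1 g2 (fun t => ltac:(rewrite /= subr_ge0 ylo; exact: up_path_above bL hc' t)) g3.
  have ha := h2 0; have ha' := g2 0.
  have [_ _ c0 _] := hc; have [_ _ c0' _] := hc'.
  rewrite c0 in ha; rewrite c0' in ha'.
  apply: (angle_of_uniq ha ha').
  have := @pi_gt0 R; rewrite ltr_norml => p0; apply/andP; split; lra.
Qed.

End Barrier.

(** * The view of the barrier from above *)

Section View.
Context {R : realType}.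
Implicit Types (u v w y z : R * R) (e r s t a b : R) (c : R -> R * R) (th : R -> R).
Implicit Types (L C : set (R * R)).

Definition view L hi z y : R := xget 0 (view_angle L hi z y).

Lemma viewP L lo hi z y : barrier L lo hi -> Up L hi z -> L y ->
  view_angle L hi z y (view L hi z y).
Proof.
move=> bL [c hc] Ly; have [a ha] := lifts_from_exists (barrier_hi bL) hc Ly.
by apply: (@xgetPex _ 0 (view_angle L hi z y)); exists a; exists c.
Qed.

Lemma view_eq L lo hi z y a : barrier L lo hi -> L y -> view_angle L hi z y a ->
  view L hi z y = a.
Proof.
move=> bL Ly ha; apply: (view_angle_uniq bL Ly _ ha).
by apply: viewP bL _ Ly; have [c hc _] := ha; exists c.
Qed.

Lemma view_angle_angle L hi z y a : view_angle L hi z y a -> angle_of (z - y) a.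
Proof. by move=> [c [_ _ <- _] [th [_ h _ <-]]]; exact: h. Qed.

(** When [z] moves along a short segment above [L], prepend that segment to the
    path to the top. *)
Lemma view_seg L lo hi z w y : barrier L lo hi -> Up L hi z -> L y ->
  (forall t, ~ L (seg z w t)) -> (forall t, 0 < dotp (z - y) (seg z w t - y)) ->
  view L hi w y = view L hi z y + parg (z - y) (w - y).
Proof.
move=> bL Uz Ly zw d0; apply: (view_eq bL Ly).
have [c hc [th [h1 h2 h3 h4]]] := viewP bL Uz Ly.
exists (ccat (seg w z) c).
  apply: up_path_cat hc; [exact: curve_seg| |exact: seg0|exact: seg1].
  by move=> t; have [s ->] := seg_rev z w t.
have d1 t : 0 < dotp ((fun=> z - y) t) (seg w z t - y).
  by have [s ->] := seg_rev z w t.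
have [g1 g2] := lift_close (curve_cst (z - y)) (curve_shift y (curve_seg w z))
  (curve_cst (view L hi z y)) d1 (fun=> view_angle_angle (viewP bL Uz Ly)).
have [_ _ c0 _] := hc.
set ph := (fun t => _) in g1 g2.
have ph1 : ph 1 = th 0 by rewrite /ph seg1 parg_self addr0 h4.
have sc : seg w z 1 = c 0 by rewrite seg1.
exists (ccat (V := R^o) ph th); split.
- exact: curve_ccat.
- move=> t; have [t2|t2] := leP t 2^-1.
    by rewrite !ccat_l// => [|//]; exact: g2.
  by rewrite !ccat_r ?ltW//; exact: h2.
- by rewrite ccat1.
- by rewrite ccat0//= /ph seg0.
Qed.

(** When [y] moves within a connected part of [L] which is seen from [z] within a
    half plane, the view follows the angle of [z - y] without jumps. *)
Lemma view_connected L lo hi z C y0 y1 : barrier L lo hi -> Up L hi z ->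
  connected C -> C `<=` L -> C y0 -> C y1 ->
  (forall y, C y -> 0 < dotp (z - y0) (z - y)) ->
  view L hi z y1 = view L hi z y0 + parg (z - y0) (z - y1).
Proof.
move=> bL Uz cC CL C0 C1 d0.
pose h y := view L hi z y - (view L hi z y0 + parg (z - y0) (z - y)).
have subc : continuous (fun y => z - y : R * R).
  by move=> y; apply: cvgB; [exact: cvg_cst|exact: cvg_id].
suff : h y1 = h y0 by rewrite /h parg_self addr0 subrr => /eqP; rewrite subr_eq0 => /eqP.
apply: (@connected_cos1_const _ _ C h) => //; last first.
  move=> y Cy; apply: angle_of_cosB (view_angle_angle (viewP bL Uz (CL _ Cy))) _.
  by apply: angle_of_parg; [exact: view_angle_angle (viewP bL Uz (CL _ C0))|exact: d0].
(* Near [y], the view is given by one fixed path to the top, from which it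
   varies by the continuous function [parg]. *)
apply/subspace_continuousP => y Cy.
have [c hc] := Uz.
have [r r0 near1] := lifts_from_near (barrier_closed bL) (barrier_hi bL) hc.
have [a ha] := lifts_from_exists (barrier_hi bL) hc (CL _ Cy).
have va : view L hi z y = a by apply: (view_eq bL (CL _ Cy)); exists c.
pose g y' := view L hi z y + parg (z - y) (z - y') - (view L hi z y0 + parg (z - y0) (z - y')).
have gy : h y = g y by rewrite /h /g parg_self addr0.
have gc : {for y, continuous g}.
  have pc x : 0 < dotp (z - x) (z - y) -> {for y, continuous (fun y' => parg (z - x) (z - y'))}.
    by move=> dx; apply: (@continuous_parg _ _ (fun=> z - x)); [exact: cvg_cst|exact: subc|].
  apply: cvgB; apply: cvgD; try exact: cvg_cst.
    apply: pc; apply: dotp_gt0_self; apply: subnz => e.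
    by apply: (Up_notin Uz); rewrite e; exact: CL.
  by apply: pc; exact: d0.
suff : h @ within C (nbhs y) --> h y by [].
rewrite gy.
have gw : g @ within C (nbhs y) --> g y.
  exact: cvg_within_filter gc.
apply: cvg_trans gw; apply: near_eq_cvg; rewrite /prop_near1 /within /=.
apply: filterS (near_close y r0) => y' yy' Cy'.
have [_ k] := near1 y y' (CL _ Cy) (CL _ Cy') yy'.
rewrite /g /h; congr (_ - _); apply/esym; apply: (view_eq bL (CL _ Cy')).
by exists c => //; apply: k; rewrite va.
Qed.

Lemma view_shift L lo hi z y (n : int) : barrier L lo hi -> Up L hi z -> L y ->
  view L hi (z.1 + n%:~R, z.2) (y.1 + n%:~R, y.2) = view L hi z y.
Proof.
move=> bL Uz Ly; apply: (view_eq bL (barrier_shiftz n bL Ly)).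
have [c [cc cL c0 c1] [th [h1 h2 h3 h4]]] := viewP bL Uz Ly.
have e t : (((c t).1 + n%:~R, (c t).2) - (y.1 + n%:~R, y.2) : R * R) = c t - y.
  by rewrite [RHS](surjective_pairing) /=; congr pair => /=; ring.
exists (fun t => ((c t).1 + n%:~R, (c t).2)).
  split => //=; last by rewrite c0.
    apply: curve_pair; last exact: curve_snd.
    by apply: curveD; [exact: curve_fst|exact: curve_cst].
  move=> t /(barrier_shiftz (- n) bL) /=.
  by rewrite rmorphN addrK -surjective_pairing; exact: cL.
by exists th; split => // t; rewrite e.
Qed.

Lemma Up_shift L lo hi z (n : int) : barrier L lo hi -> Up L hi z ->
  Up L hi (z.1 + n%:~R, z.2).
Proof.
move=> bL [c [cc cL c0 c1]]; exists (fun t => ((c t).1 + n%:~R, (c t).2)).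
split => //=; last by rewrite c0.
  apply: curve_pair; last exact: curve_snd.
  by apply: curveD; [exact: curve_fst|exact: curve_cst].
move=> t /(barrier_shiftz (- n) bL) /=.
by rewrite rmorphN addrK -surjective_pairing; exact: cL.
Qed.

Lemma curve_bounded (c : R -> R) : curve c -> exists B, forall t, - B < c t < B.
Proof.
move=> [cc cE].
have [||e e0 h] := @itv_unif R (fun e t => - e^-1 < c t < e^-1).
- move=> e e' x e'0 ee' /andP[h1 h2].
  have : e^-1 <= e'^-1 by rewrite lef_pV2 ?posrE//; exact: lt_le_trans ee'.
  by move=> *; apply/andP; split; lra.
- move=> x _; exists (`|c x| + 1)^-1; first by rewrite invr_gt0 ltr_wpDl.
  have /cvgrPdist_lt/(_ 1 ltr01) := cc x.
  apply: filterS => y; rewrite invrK ltr_norml => /andP[h1 h2].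
  have := ler_norm (c x); have := ler_norm (- c x); rewrite normrN.
  by move=> *; apply/andP; split; lra.
by exists e^-1 => t; rewrite cE; apply: h; exact: clamp_itv.
Qed.

(** From points of [L] far to the left or to the right of the whole path, the
    path remains in a half plane.  The bound [B] is uniform over the translates
    of [z] because the view is invariant under translation. *)
Lemma view_side L lo hi z : barrier L lo hi -> exists2 B, 0 < B & forall (n : int) y,
  L y -> Up L hi (z.1 + n%:~R, z.2) ->
  (B < z.1 + n%:~R - y.1 -> `|view L hi (z.1 + n%:~R, z.2) y| < pi / 2) /\
  (z.1 + n%:~R - y.1 < - B -> `|view L hi (z.1 + n%:~R, z.2) y - pi| < pi / 2).
Proof.
move=> bL.
have [Uz|nUz] := pselect (Up L hi z); last first.
  exists 1 => // n y _ /(Up_shift (- n) bL) /=.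
  by rewrite rmorphN addrK -surjective_pairing.
have [c hc] := Uz; have [cc cL c0 c1] := hc.
have [B hB] := curve_bounded (curve_fst cc).
have Bpos : 0 < B by have := hB 0; lra.
exists (B + `|z.1|) => [|n y Ly _].
  by rewrite ltr_pwDl.
pose y' := (y.1 + (- n)%:~R, y.2).
have Ly' : L y' by exact: barrier_shiftz bL Ly.
have -> : view L hi (z.1 + n%:~R, z.2) y = view L hi z y'.
  by rewrite -(view_shift n bL Uz Ly') /= -addrA -intrD addNr addr0 -surjective_pairing.
have [a [th [h1 h2 h3 h4]]] := lifts_from_exists (barrier_hi bL) hc Ly'.
have -> : view L hi z y' = a.
  by apply: (view_eq bL Ly'); exists c => //; exists th.
have y'E : y'.1 = y.1 - n%:~R by rewrite /y' /= rmorphN.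
have zn1 := ler_norm (z.1); have := ler_norm (- z.1); rewrite normrN => zn2.
rewrite -h4; split => hy.
- by apply: (lift_east h1.1 h2) => // t; rewrite /= subr_gt0; have := hB t; lra.
- by apply: (lift_west h1.1 h2) => // t; rewrite /= subr_lt0; have := hB t; lra.
Qed.

Definition near_set L r v := exists2 q, L q & close r q v.

(** A determination [psi] of the angle of the displacement [v - F v] at the points
    [v] that lie above [L] and close to it.  Choose [q] in [L] close to [v];
    then [F q] belongs to [L], so [v] has a view from [F q], and [v - F v] is
    close to [v - F q].  Two choices of [q] are joined by a small connected part
    of [L], by local connectedness, so the choice does not matter, and [psi]
    varies with the small angles between displacements along segments that do
    not cross [L].  The last property pins [psi] down where the displacement has a
    large horizontal component. *)
Lemma upper_branch L lo hi (F : R * R -> R * R) rho h :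
  barrier L lo hi -> continuous F -> (forall z, L z -> L (F z)) ->
  0 < rho -> 0 < h -> h <= rho / 32 ->
  (forall v q, L q -> close (2 * h) q v -> ~ close rho (0, 0) (v - F v)) ->
  (forall v q, L q -> close (2 * h) q v -> close (rho / 32) (F q) (F v)) ->
  (forall v w, L v -> L w -> close (8 * h) v w -> exists C,
     [/\ connected C, C `<=` L, C v, C w & forall y, C y -> close (rho / 32) (F v) (F y)]) ->
  exists psi : R * R -> R, [/\
    forall v, Up L hi v -> near_set L (2 * h) v -> angle_of (v - F v) (psi v),
    forall v w, Up L hi v -> near_set L (2 * h) v -> near_set L (2 * h) w ->
      close (2 * h) v w -> (forall t, ~ L (seg v w t)) ->
      psi w = psi v + parg (v - F v) (w - F w) &
    forall s : seq (R * R), exists B, forall z (n : int), z \in s ->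
      let v := (z.1 + n%:~R, z.2) in Up L hi v -> near_set L (2 * h) v ->
      (B < (v - F v).1 -> `|psi v| < pi / 2) /\
      ((v - F v).1 < - B -> `|psi v - pi| < pi / 2)].
Proof.
move=> bL Fc FL rho0 h0 hrho S1 S2 S3.
have /choice[q hq] : forall v, exists q, near_set L (2 * h) v -> L q /\ close (2 * h) q v.
  move=> v; have [[q Lq qv]|nn] := pselect (near_set L (2 * h) v); first by exists q.
  by exists v => /nn.
pose psi v := view L hi v (F (q v)) + parg (v - F (q v)) (v - F v).
exists psi.
have ang v : Up L hi v -> near_set L (2 * h) v -> angle_of (v - F v) (psi v).
  move=> Uv nv; have [Lq cq] := hq v nv.
  apply: angle_of_parg; first exact: view_angle_angle (viewP bL Uv (FL _ Lq)).
  apply: (dotp_gt0_far rho0 (S1 v _ Lq cq)); last by apply: close_refl; lra.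
  have [*] := S2 v _ Lq cq; split => /=; lra.
split=> //.
- move=> v w Uv nv nw vw segL.
  have [Lv cv] := hq v nv; have [Lw cw] := hq w nw.
  have Uw : Up L hi w := Up_seg Uv segL.
  set v' := q v in Lv cv *; set w' := q w in Lw cw *.
  have [C [cC CL Cv Cw hC]] : exists C, [/\ connected C, C `<=` L, C v', C w' &
      forall y, C y -> close (rho / 32) (F v') (F y)].
    apply: S3 => //; apply: close_le (close_trans (close_trans cv vw) (close_sym cw)); lra.
  have far := S1 v _ Lv cv.
  have Fv := S2 v _ Lv cv; have Fw := S2 w _ Lw cw.
  (* All displacements that occur below lie in one square far from the origin, so
     the angles between them add up. *)
  have near_b : close (rho / 4) (v - F v) (v - F v').
    by move: Fv => [*]; split => /=; lra.
  have near_a : close (rho / 4) (v - F v) (v - F v) by apply: close_refl; lra.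
  have near_s t : close (rho / 4) (v - F v) (seg v w t - F v').
    apply: close_le (close_sub (seg_close t vw) (close_sym Fv)); lra.
  have near_e y : C y -> close (rho / 4) (v - F v) (w - F y).
    move=> /hC Fy; apply: close_le (close_sub vw (close_trans (close_sym Fv) Fy)); lra.
  have near_g : close (rho / 4) (v - F v) (w - F w).
    apply: close_le (close_sub vw (close_trans (close_trans (close_sym Fv) (hC _ Cw)) Fw)); lra.
  have dot x y := dotp_gt0_far rho0 far (w := x) (z := y).
  have near_c : close (rho / 4) (v - F v) (w - F v') by have := near_s 1; rewrite seg1.
  have e1 : view L hi w (F v') = view L hi v (F v') + parg (v - F v') (w - F v').
    apply: (view_seg bL Uv (FL _ Lv) segL) => t; exact: dot.
  have e2 : view L hi w (F w') = view L hi w (F v') + parg (w - F v') (w - F w').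
    apply: (@view_connected _ _ _ _ [set F y | y in C]) => //.
    + by exact: bL.
    + by apply: connected_continuous_connected => //; exact: continuous_subspaceT.
    + by move=> _ [y Cy <-]; exact/FL/CL.
    + by exists v'.
    + by exists w'.
    + by move=> _ [y Cy <-]; apply: dot => //; exact: near_e.
  rewrite /psi e2 e1 -/v' -/w' -!addrA; congr (_ + _).
  have near_w' := near_e _ Cw.
  rewrite (@parg_cocycle _ (w - F v')) ?(@parg_cocycle _ (v - F v')); try exact: dot.
  by [].
- elim=> [|z s [B hB]]; first by exists 0.
  have [B' B'0 hB'] := view_side z bL.
  exists (Num.max B (B' + rho)) => x n; rewrite inE => /orP[/eqP ->|xs] v Uv nv; last first.
    have [k1 k2] := hB x n xs Uv nv.
    have : B <= Num.max B (B' + rho) by rewrite le_max lexx.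
    by split => *; [apply: k1; lra|apply: k2; lra].
  have : B' + rho <= Num.max B (B' + rho) by rewrite le_max lexx orbT.
  set M := Num.max _ _ => BM.
  have [Lq cq] := hq v nv.
  have [k1 k2] := hB' n (F (q v)) (FL _ Lq) Uv.
  have [f1 f2 f3 f4] := S2 v _ Lq cq.
  have := parg_bound (v - F (q v)) (v - F v); rewrite ltr_norml => /andP[p1 p2].
  have av := ang v Uv nv.
  have vE : (v - F v).1 = z.1 + n%:~R - (F v).1 by [].
  have p0 := @pi_gt0 R.
  split=> hV.
  + have := k1 ltac:(lra); rewrite ltr_norml => /andP[g1 g2].
    have : `|psi v - 0| < pi / 2.
      apply: (angle_of_near (@angle_of_east R) av).
        rewrite /dotp [(1, 0).1]/= [(1, 0).2]/= mul1r mul0r addr0; lra.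
      by rewrite subr0 /psi ltr_norml; apply/andP; split; lra.
    by rewrite subr0.
  + have := k2 ltac:(lra); rewrite ltr_norml => /andP[g1 g2].
    apply: (angle_of_near (@angle_of_west R) av).
      rewrite /dotp [(-1, 0).1]/= [(-1, 0).2]/= mul0r addr0; lra.
    by rewrite /psi ltr_norml; apply/andP; split; lra.
Qed.

End View.

(** * Reflection in the horizontal axis *)

Section Reflection.
Context {R : realType}.
Implicit Types (u v w y z : R * R) (e r s t a b : R) (L C : set (R * R)).

Definition refl z : R * R := (z.1, - z.2).
Definition reflected L : set (R * R) := [set z | L (refl z)].

Lemma reflK z : refl (refl z) = z.
Proof. by rewrite /refl /= opprK; case: z. Qed.

Lemma continuous_refl : continuous refl.
Proof.
apply: continuous_plane => z; first exact: cvg_fst.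
by apply: cvgN; exact: cvg_snd.
Qed.

Lemma close_reflE e z w : close e (refl z) (refl w) <-> close e z w.
Proof.
case: z w => [a b] [c d]; rewrite /close /refl /=.
by split => -[? ? ? ?]; split; lra.
Qed.

Lemma refl_seg z w t : seg (refl z) (refl w) t = refl (seg z w t).
Proof. by rewrite /seg /refl /=; congr pair; ring. Qed.

Lemma parg_refl u v : parg (refl u) (refl v) = - parg u v.
Proof.
rewrite /parg -atanN; congr atan; rewrite /crossp /dotp /refl /= mulrNN mulrN mulNr.
by rewrite -[RHS]mulNr; congr (_ * _); ring.
Qed.

Lemma angle_of_refl u a : angle_of (refl u) (- a) <-> angle_of u a.
Proof.
split=> -[r r0 e]; exists r => //; move: e; rewrite ?cosN ?sinN.
  by case: u => x y; rewrite /refl /= mulrN => -[-> /oppr_inj ->].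
by move=> ->; rewrite /refl /= mulrN.
Qed.

Lemma reflB u v : refl u - refl v = refl (u - v).
Proof. by rewrite [LHS]surjective_pairing /refl /=; congr pair; rewrite opprD. Qed.

Lemma curve_rev (T : topologicalType) (c : R -> T) : curve c ->
  curve (fun t => c (1 - clamp t)).
Proof.
move=> [cc cE]; split; last by move=> t; rewrite clampK.
move=> t; apply: (@continuous_comp _ _ _ (fun t => 1 - clamp t) c); last exact: cc.
by apply: cvgB; [exact: cvg_cst|exact: continuous_clamp].
Qed.

Lemma barrier_refl L lo hi : barrier L lo hi -> barrier (reflected L) (- hi) (- lo).
Proof.
move=> bL; split.
- by apply: closed_comp (barrier_closed bL) => z _; exact: continuous_refl.
- by move=> z /(barrier_succ bL).
- by move=> z /(barrier_pred bL).
- by move=> z /(barrier_hi bL) /=; lra.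
- by move=> z /(barrier_lo bL) /=; lra.
- have [z Lz zh] := barrier_hi_ex bL; exists (refl z); last by rewrite /= zh.
  by rewrite /reflected /= reflK.
- have [z Lz zh] := barrier_lo_ex bL; exists (refl z); last by rewrite /= zh.
  by rewrite /reflected /= reflK.
- move=> P h1 h2 h3 [z0 Lz0 Pz0] z Lz.
  rewrite -(reflK z); apply: (barrier_conn bL (P := fun z => P (refl z))) Lz.
  + by move=> w Lw; apply: h1; rewrite /reflected /= reflK.
  + by move=> w Lw; apply: h2; rewrite /reflected /= reflK.
  + move=> w Lw; have [|e e0 he] := h3 (refl w); first by rewrite /reflected /= reflK.
    exists e => // x Lx wx; apply: he; first by rewrite /reflected /= reflK.
    exact/close_reflE.
  + by exists (refl z0) => //; rewrite reflK.
- move=> e e0; have [r r0 h] := barrier_ulc bL e0.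
  exists r => // v w Lv Lw vw; have [C [cC CL Cv Cw hC]] := h _ _ Lv Lw (proj2 (close_reflE _ _ _) vw).
  exists [set refl y | y in C]; split.
  + apply: connected_continuous_connected => //; apply: continuous_subspaceT; exact: continuous_refl.
  + by move=> _ [y Cy <-]; rewrite /reflected /= reflK; exact: CL.
  + by exists (refl v) => //; rewrite reflK.
  + by exists (refl w) => //; rewrite reflK.
  + by move=> _ [y Cy <-]; rewrite -[v]reflK; apply/close_reflE; exact: hC.
- move=> c cc cL c0 c1.
  apply: (barrier_sep bL (c := fun t => refl (c (1 - clamp t)))).
  + exact: (curve_comp continuous_refl (curve_rev cc)).
  + by move=> t; exact: cL.
  + by rewrite clamp0 subr0 /=; lra.
  + by rewrite clamp1 subrr /=; lra.
Qed.

Definition Down L lo z := Up (reflected L) (- lo) (refl z).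

Lemma Up_Down L lo hi z : barrier L lo hi -> Up L hi z -> Down L lo z -> False.
Proof.
move=> bL [c hc] [c' [cc' cL' c0' c1']].
have cr := curve_comp continuous_refl (curve_rev cc').
have [] := @up_path_cat _ L hi z (refl (c' 1)) c (fun t => refl (c' (1 - clamp t))) cr _ _ _ hc.
- by move=> t; exact: cL'.
- by rewrite clamp0 subr0.
- by rewrite clamp1 subrr c0' reflK.
move=> h1 h2 h3 h4; apply: (barrier_sep bL h1 h2 _ h4).
by rewrite h3 /=; lra.
Qed.

Lemma Down_seg L lo z w : Down L lo z -> (forall t, ~ L (seg z w t)) -> Down L lo w.
Proof.
move=> Dz zw; apply: (Up_seg Dz) => t; rewrite refl_seg /reflected /= reflK; exact: zw.
Qed.

Lemma Down_notin L lo z : Down L lo z -> ~ L z.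
Proof. by move=> /Up_notin; rewrite /reflected /= reflK. Qed.

Lemma Down_low L lo z : (forall z, L z -> lo <= z.2) -> z.2 < lo -> Down L lo z.
Proof.
move=> h zl; apply: Up_high; last by rewrite /=; lra.
by move=> w /h /=; lra.
Qed.

(** The counterpart of [upper_branch] below [L], obtained by reflection; this is
    why [- pi] replaces [pi] where the displacement points to the left. *)
Lemma lower_branch L lo hi (F : R * R -> R * R) rho h :
  barrier L lo hi -> continuous F -> (forall z, L z -> L (F z)) ->
  0 < rho -> 0 < h -> h <= rho / 32 ->
  (forall v q, L q -> close (2 * h) q v -> ~ close rho (0, 0) (v - F v)) ->
  (forall v q, L q -> close (2 * h) q v -> close (rho / 32) (F q) (F v)) ->
  (forall v w, L v -> L w -> close (8 * h) v w -> exists C,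
     [/\ connected C, C `<=` L, C v, C w & forall y, C y -> close (rho / 32) (F v) (F y)]) ->
  exists psi : R * R -> R, [/\
    forall v, Down L lo v -> near_set L (2 * h) v -> angle_of (v - F v) (psi v),
    forall v w, Down L lo v -> near_set L (2 * h) v -> near_set L (2 * h) w ->
      close (2 * h) v w -> (forall t, ~ L (seg v w t)) ->
      psi w = psi v + parg (v - F v) (w - F w) &
    forall s : seq (R * R), exists B, forall z (n : int), z \in s ->
      let v := (z.1 + n%:~R, z.2) in Down L lo v -> near_set L (2 * h) v ->
      (B < (v - F v).1 -> `|psi v| < pi / 2) /\
      ((v - F v).1 < - B -> `|psi v + pi| < pi / 2)].
Proof.
move=> bL Fc FL rho0 h0 hrho S1 S2 S3.
pose F' z := refl (F (refl z)).
have VE v : refl v - F' (refl v) = refl (v - F v) by rewrite /F' reflK reflB.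
have nE v : near_set (reflected L) (2 * h) (refl v) <-> near_set L (2 * h) v.
  split=> -[q Lq qv]; exists (refl q) => //.
  - by rewrite -[v]reflK; exact/close_reflE.
  - by rewrite /reflected /= reflK.
  - exact/close_reflE.
have fr r u : close r (0, 0) (refl u) <-> close r (0, 0) u.
  have -> : (0, 0) = refl (0, 0) :> R * R by rewrite /refl /= oppr0.
  by rewrite close_reflE {1}/refl /= oppr0.
have F'c : continuous F'.
  by move=> z; apply: continuous_comp; [apply: continuous_comp; [exact: continuous_refl|exact: Fc]|exact: continuous_refl].
have F'L z : reflected L z -> reflected L (F' z).
  by move=> Lz; rewrite /reflected /= reflK; exact: FL.
have [|||psi [h1 h2 h3]] := @upper_branch _ (reflected L) (- hi) (- lo) F' rho h (barrier_refl bL) F'c F'L rho0 h0 hrho.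
- move=> v q Lq qv; rewrite -[v]reflK VE fr.
  by apply: (S1 _ _ Lq); exact/close_reflE.
- move=> v q Lq qv; apply/close_reflE; apply: (S2 _ _ Lq); exact/close_reflE.
- move=> v w Lv Lw vw.
  have [C [cC CL Cv Cw hC]] := S3 _ _ Lv Lw (proj2 (close_reflE _ _ _) vw).
  exists [set refl y | y in C]; split.
  + apply: connected_continuous_connected => //; apply: continuous_subspaceT; exact: continuous_refl.
  + by move=> _ [y Cy <-]; rewrite /reflected /= reflK; exact: CL.
  + by exists (refl v) => //; rewrite reflK.
  + by exists (refl w) => //; rewrite reflK.
  + by move=> _ [y Cy <-]; rewrite /F' reflK; apply/close_reflE; exact: hC.
exists (fun v => - psi (refl v)); split.
- move=> v Dv nv; apply/angle_of_refl; rewrite opprK -VE.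
  by apply: h1 => //; exact/nE.
- move=> v w Dv nv nw vw vL.
  rewrite (h2 (refl v) (refl w)) ?VE ?parg_refl ?opprD ?opprK//.
  + exact/nE.
  + exact/nE.
  + exact/close_reflE.
  + by move=> t; rewrite refl_seg /reflected /= reflK; exact: vL.
- move=> s; have [B hB] := h3 (map refl s); exists B => z n zs v Dv nv.
  have [k1 k2] := hB (refl z) n (map_f _ zs) Dv (proj2 (nE v) nv).
  have e : (refl v - F' (refl v)).1 = (v - F v).1 by rewrite VE.
  rewrite /= in e k1 k2 *; rewrite e in k1 k2.
  split=> hv; first by rewrite normrN; exact: k1.
  by rewrite addrC -normrN opprB; exact: k2.
Qed.

End Reflection.

(** * Turning of a displacement field along a grid *)

Section PlaneFixedPoint.
Context {R : realType}.
Implicit Types (u v w y z : R * R) (e r s t a b : R) (L C : set (R * R)).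

Lemma box_unif (a b c d : R) (Q : R -> R * R -> Prop) :
  (forall e e' z, 0 < e' -> e' <= e -> Q e z -> Q e' z) ->
  (forall z, exists2 e, 0 < e & \forall y \near z, Q e y) ->
  exists2 e, 0 < e & forall z, a <= z.1 <= b -> c <= z.2 <= d -> Q e z.
Proof.
move=> mono loc.
have cI (x y : R) : compact [set t : R | x <= t <= y].
  have -> : [set t : R | x <= t <= y] = `[x, y]%classic by apply/seteqP; split => t /=; rewrite in_itv.
  exact: segment_compact.
have cB := compact_setX (cI a b) (cI c d).
have [e e0 h] := compact_unif cB mono (fun z _ => loc z).
by exists e => // z z1 z2; apply: h; split.
Qed.

(** A translation invariant property need only be examined over one period, which
    is compact. *)
Lemma strip_unif (c d : R) (Q : R -> R * R -> Prop) :
  (forall e e' z, 0 < e' -> e' <= e -> Q e z -> Q e' z) ->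
  (forall z, exists2 e, 0 < e & \forall y \near z, Q e y) ->
  (forall e z (n : int), Q e z -> Q e (z.1 + n%:~R, z.2)) ->
  exists2 e, 0 < e & forall z, c <= z.2 <= d -> Q e z.
Proof.
move=> mono loc per; have [e e0 h] := @box_unif 0 1 c d Q mono loc.
exists e => // z hz; have /andP[f1 f2] := floor_itv z.1.
rewrite intrD in f2.
have := per e (z.1 - (Num.floor z.1)%:~R, z.2) (Num.floor z.1).
rewrite /= subrK -surjective_pairing; apply; apply: h => //=.
by apply/andP; split; lra.
Qed.

(** The points from which neither end of the strip can be reached: [L] and the
    regions that it encloses. *)
Definition filled L lo hi z := ~ Up L hi z /\ ~ Down L lo z.

Lemma Up_open L lo hi z : barrier L lo hi -> Up L hi z ->
  exists2 e, 0 < e & forall w, close e z w -> Up L hi w.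
Proof.
move=> bL Uz.
have : nbhs z (~` L).
  by apply: open_nbhs_nbhs; split; [exact: closed_openC (barrier_closed bL)|exact: Up_notin Uz].
move=> /nbhs_closeP[e e0 he]; exists e => // w zw.
by apply: (Up_seg Uz) => t; apply: he; exact: seg_close.
Qed.

Lemma Down_open L lo hi z : barrier L lo hi -> Down L lo z ->
  exists2 e, 0 < e & forall w, close e z w -> Down L lo w.
Proof.
move=> bL Dz; have [e e0 h] := Up_open (barrier_refl bL) Dz.
by exists e => // w zw; apply: h; exact/close_reflE.
Qed.

Lemma filled_strip L lo hi z : barrier L lo hi -> filled L lo hi z -> lo <= z.2 <= hi.
Proof.
move=> bL [nU nD]; apply/andP; split; rewrite leNgt; apply/negP => h.
  by apply: nD; apply: Down_low => //; exact: barrier_lo bL.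
by apply: nU; apply: Up_high => //; exact: barrier_hi bL.
Qed.

Lemma filled_in L lo hi z : L z -> filled L lo hi z.
Proof. by move=> Lz; split; [move=> /Up_notin|move=> /Down_notin]. Qed.

(** The discrete Green formula: if the increments around every small square
    cancel, so do those around the rectangle. *)
Lemma grid_sum (H W : nat -> nat -> R) (I J : nat) :
  (forall i j, (i < I)%N -> (j < J)%N -> H i j + W i.+1 j = W i j + H i j.+1) ->
  \sum_(0 <= i < I) H i 0%N + \sum_(0 <= j < J) W I j =
  \sum_(0 <= j < J) W 0%N j + \sum_(0 <= i < I) H i J.
Proof.
move=> sq.
have col i : (i < I)%N -> forall k, (k <= J)%N ->
    H i 0%N + \sum_(0 <= j < k) W i.+1 j = \sum_(0 <= j < k) W i j + H i k.
  move=> iI; elim=> [_|k IH kJ]; first by rewrite !big_geq// addr0 add0r.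
  rewrite !big_nat_recr//= addrA IH ?(ltnW kJ)// -!addrA; congr (_ + _).
  exact: sq.
have : forall k, (k <= I)%N -> \sum_(0 <= i < k) H i 0%N + \sum_(0 <= j < J) W k j =
    \sum_(0 <= j < J) W 0%N j + \sum_(0 <= i < k) H i J.
  elim=> [_|k IH kI]; first by rewrite ![\sum_(0 <= _ < 0) _]big_geq// addr0 add0r.
  rewrite !big_nat_recr//= -addrA col// addrA IH ?(ltnW kI)//.
  by rewrite -!addrA.
exact.
Qed.

Lemma parg_square rho v1 v2 v3 v4 : 0 < rho -> ~ close rho (0, 0) v1 ->
  close (rho / 4) v1 v2 -> close (rho / 4) v1 v3 -> close (rho / 4) v1 v4 ->
  parg v1 v2 + parg v2 v3 = parg v1 v4 + parg v4 v3.
Proof.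
move=> rho0 far c2 c3 c4.
have c1 : close (rho / 4) v1 v1 by apply: close_refl; lra.
have dot x y := dotp_gt0_far rho0 far (w := x) (z := y).
by rewrite !parg_cocycle//; exact: dot.
Qed.

End PlaneFixedPoint.

Section GridTurning.
Context {R : realType}.
Variables (L : set (R * R)) (lo hi : R) (F : R * R -> R * R) (rho h : R).
Variables (psiU psiD : R * R -> R).
Implicit Types (v w z q : R * R).
Hypothesis bL : barrier L lo hi.
Hypotheses (rho0 : 0 < rho) (h0 : 0 < h) (hrho : h <= rho / 32).
Let V v : R * R := v - F v.
Hypothesis far : forall z v, filled L lo hi z -> close (2 * h) z v -> ~ close rho (0, 0) (V v).
Hypothesis Fnear : forall z v, lo - 1 <= z.2 <= hi + 1 -> close (2 * h) z v ->
  close (rho / 32) (F z) (F v).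
Hypothesis h1 : 2 * h <= 1.
Hypothesis stepU : forall v w, Up L hi v -> near_set L (2 * h) v -> near_set L (2 * h) w ->
      close (2 * h) v w -> (forall t, ~ L (seg v w t)) ->
      psiU w = psiU v + parg (V v) (V w).
Hypothesis stepD : forall v w, Down L lo v -> near_set L (2 * h) v -> near_set L (2 * h) w ->
      close (2 * h) v w -> (forall t, ~ L (seg v w t)) ->
      psiD w = psiD v + parg (V v) (V w).

Lemma scale_bounds : [/\ 0 < rho, 0 < h, h <= rho / 32 & 2 * h <= 1].
Proof. by []. Qed.

(** The turning assigned to an edge of the grid.  Along an edge above or below
    [L] it is the difference of [psiU] or [psiD], even far from [L] where these
    functions carry no information: only their values at the corners of the
    rectangle will remain in the sum.  On all other edges, it is the angle
    between the displacements at the two ends. *)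
Definition incr v w : R :=
  if pselect (forall t, ~ L (seg v w t)) then
    if pselect (Up L hi v) then psiU w - psiU v
    else if pselect (Down L lo v) then psiD w - psiD v else parg (V v) (V w)
  else parg (V v) (V w).

Lemma incr_Up v w : (forall t, ~ L (seg v w t)) -> Up L hi v -> incr v w = psiU w - psiU v.
Proof. by rewrite /incr => a b; case: pselect => // ?; case: pselect. Qed.

Lemma incr_Down v w : (forall t, ~ L (seg v w t)) -> Down L lo v -> incr v w = psiD w - psiD v.
Proof.
rewrite /incr => a b; case: pselect => // ?; case: pselect => [|nUv].
  by move=> Uv; case: (Up_Down bL Uv b).
by case: pselect.
Qed.

Lemma incr_filled v w : filled L lo hi v -> incr v w = parg (V v) (V w).
Proof. by rewrite /incr => -[nU nD]; case: pselect => // ?; do 2!case: pselect => //. Qed.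

(** Close to [L] the two definitions of the turning agree, by the defining
    property of [psiU] and [psiD]. *)
Lemma incr_near v w : near_set L (2 * h) v -> near_set L (2 * h) w ->
  close (2 * h) v w -> incr v w = parg (V v) (V w).
Proof.
move=> nv nw vw; rewrite /incr; case: pselect => // av; case: pselect => [Uv|nUv].
  by rewrite (stepU Uv nv nw vw av) addrAC subrr add0r.
case: pselect => // Dv.
by rewrite (stepD Dv nv nw vw av) addrAC subrr add0r.
Qed.

Lemma filled_seg v w : (forall t, ~ L (seg v w t)) -> filled L lo hi v -> filled L lo hi w.
Proof.
move=> a [nU nD]; have a' t : ~ L (seg w v t) by have [s ->] := seg_rev v w t.
by split=> ?; [apply: nU; exact: Up_seg a'|apply: nD; exact: Down_seg a'].
Qed.

Definition near_filled v := exists2 q, filled L lo hi q & close (2 * h) q v.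

Lemma near_filled_L v : near_set L (2 * h) v -> near_filled v.
Proof. by move=> [q Lq qv]; exists q => //; exact: filled_in. Qed.

Lemma filled_near v : filled L lo hi v -> near_filled v.
Proof.
have [? ? ? ?] := scale_bounds.
by move=> fv; exists v => //; apply: close_refl; lra. Qed.

Lemma near_filled_far v : near_filled v -> ~ close rho (0, 0) (V v).
Proof. by move=> [q fq qv]; exact: far qv. Qed.

Lemma near_filled_strip v : near_filled v -> lo - 1 <= v.2 <= hi + 1.
Proof.
have [? ? ? ?] := scale_bounds.
move=> [q /(filled_strip bL) /andP[a b] [_ _ c d]].
by apply/andP; split; lra.
Qed.

Lemma near_filled_V v w : near_filled v -> close (2 * h) v w -> close (rho / 4) (V v) (V w).
Proof.
have [? ? ? ?] := scale_bounds.
move=> nv vw; have [? ? ? ?] := Fnear (near_filled_strip nv) vw.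
by move: vw => [? ? ? ?]; rewrite /V; split => /=; lra.
Qed.

(** If no edge of the square meets [L], all four edges lie above [L], or all
    below, or all in the filled set; in the first two cases the sum telescopes.  In all
    other cases the vertices are close to the filled set, the turnings are angles
    between nearby nonzero displacements, and these add up. *)
Lemma incr_square x y :
  incr (x, y) (x + h, y) + incr (x + h, y) (x + h, y + h) =
  incr (x, y) (x, y + h) + incr (x, y + h) (x + h, y + h).
Proof.
have [? ? ? ?] := scale_bounds.
set v1 := (x, y); set v2 := (x + h, y); set v3 := (x + h, y + h); set v4 := (x, y + h).
have cc (a b c d : R) : a - h <= c -> c <= a + h -> b - h <= d -> d <= b + h ->
    close (2 * h) (a, b) (c, d).
  by move=> *; split => /=; lra.
have final : near_filled v1 ->
    parg (V v1) (V v2) + parg (V v2) (V v3) = parg (V v1) (V v4) + parg (V v4) (V v3).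
  move=> n1; apply: (parg_square rho0 (near_filled_far n1)); apply: near_filled_V => //;
    apply: cc; lra.
have [[a12 [a23 [a14 a43]]]|hit] := pselect ((forall t, ~ L (seg v1 v2 t)) /\
  (forall t, ~ L (seg v2 v3 t)) /\ (forall t, ~ L (seg v1 v4 t)) /\ (forall t, ~ L (seg v4 v3 t))).
- have [U1|nU1] := pselect (Up L hi v1).
    have U2 := Up_seg U1 a12; have U4 := Up_seg U1 a14.
    by rewrite !incr_Up//; ring.
  have [D1|nD1] := pselect (Down L lo v1).
    have D2 := Down_seg D1 a12; have D4 := Down_seg D1 a14.
    by rewrite !incr_Down//; ring.
  have f1 : filled L lo hi v1 by [].
  have f2 := filled_seg a12 f1; have f4 := filled_seg a14 f1.
  rewrite !incr_filled//.
  by apply: final; exact: filled_near.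
- have [q Lq [q1 q2 q3 q4]] : exists2 q, L q & [/\ x <= q.1, q.1 <= x + h, y <= q.2 & q.2 <= y + h].
    apply: contrapT => nq; apply: hit.
    have sg u w : x <= u.1 <= x + h -> x <= w.1 <= x + h -> y <= u.2 <= y + h -> y <= w.2 <= y + h ->
        forall t, ~ L (seg u w t).
      move=> /andP[? ?] /andP[? ?] /andP[? ?] /andP[? ?] t Lt; apply: nq; exists (seg u w t) => //.
      by have /andP[? ?] := clamp_itv t; rewrite /seg; split => /=; nra.
    by do !split; apply: sg => /=; apply/andP; split; lra.
  have nr (a b : R) : x <= a -> a <= x + h -> y <= b -> b <= y + h -> near_set L (2 * h) (a, b).
    by move=> *; exists q => //; split => /=; lra.
  have n1 : near_set L (2 * h) v1 by apply: nr; lra.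
  have n2 : near_set L (2 * h) v2 by apply: nr; lra.
  have n3 : near_set L (2 * h) v3 by apply: nr; lra.
  have n4 : near_set L (2 * h) v4 by apply: nr; lra.
  have c12 : close (2 * h) v1 v2 by apply: cc; lra.
  have c23 : close (2 * h) v2 v3 by apply: cc; lra.
  have c14 : close (2 * h) v1 v4 by apply: cc; lra.
  have c43 : close (2 * h) v4 v3 by apply: cc; lra.
  rewrite !incr_near//.
  by apply: final; exact: near_filled_L.
Qed.

(** The turning along a vertical side on which a determination [al] of the angle
    of the displacement is available near the filled set: the partial turnings
    telescope to the values at the two ends, up to the difference [kappa]
    between [al] and [psiD]. *)
Lemma incr_side (x y th0 kappa : R) (al : R * R -> R) (J : nat) :
  let vt j := (x, y + j%:R * h) in
  (forall j, (j <= J)%N -> near_filled (vt j) ->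
     angle_of (V (vt j)) (al (vt j)) /\ `|al (vt j) - th0| < pi / 2) ->
  (forall j, (j <= J)%N -> Up L hi (vt j) -> near_set L (2 * h) (vt j) ->
     psiU (vt j) = al (vt j)) ->
  (forall j, (j <= J)%N -> Down L lo (vt j) -> near_set L (2 * h) (vt j) ->
     psiD (vt j) + kappa = al (vt j)) ->
  Down L lo (vt 0%N) -> Up L hi (vt J) ->
  \sum_(0 <= j < J) incr (vt j) (vt j.+1) = psiU (vt J) - (psiD (vt 0%N) + kappa).
Proof.
have [? ? ? ?] := scale_bounds.
move=> vt hal hU hD D0 UJ.
(* A single potential for all edges of the side. *)
pose A v := if pselect (Up L hi v) then psiU v else
  if pselect (Down L lo v) then psiD v + kappa else al v.
have AU v : Up L hi v -> A v = psiU v by rewrite /A; case: pselect.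
have AD v : Down L lo v -> A v = psiD v + kappa.
  move=> Dv; rewrite /A; case: pselect => [Uv|nUv]; first by case: (Up_Down bL Uv Dv).
  by case: pselect.
have AF v : filled L lo hi v -> A v = al v.
  by move=> [nU nD]; rewrite /A; do 2!case: pselect => //.
have AN j : (j <= J)%N -> near_set L (2 * h) (vt j) -> A (vt j) = al (vt j).
  move=> jJ nj; rewrite /A; case: pselect => [U|nU]; first exact: hU.
  by case: pselect => [D|nD]; first exact: hD.
have vstep j : close (2 * h) (vt j) (vt j.+1).
  by rewrite /vt -natr1; split => /=; lra.
have fin j : (j < J)%N -> near_filled (vt j) -> near_filled (vt j.+1) ->
    parg (V (vt j)) (V (vt j.+1)) = al (vt j.+1) - al (vt j).
  move=> jJ n1 n2; have [a1 b1] := hal j (ltnW jJ) n1; have [a2 b2] := hal _ jJ n2.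
  have d0 : 0 < dotp (V (vt j)) (V (vt j.+1)).
    apply: (dotp_gt0_far rho0 (near_filled_far n1)); last exact: near_filled_V.
    by apply: close_refl; lra.
  rewrite (angle_of_pargP a1 a2 d0); first by rewrite addrAC subrr add0r.
  move: b1 b2; rewrite !ltr_norml => /andP[? ?] /andP[? ?]; apply/andP; split; lra.
have inc j : (j < J)%N -> incr (vt j) (vt j.+1) = A (vt j.+1) - A (vt j).
  move=> jJ; have [av|hit] := pselect (forall t, ~ L (seg (vt j) (vt j.+1) t)).
  - have [U|nU] := pselect (Up L hi (vt j)).
      by rewrite incr_Up// !AU//; exact: Up_seg av.
    have [D|nD] := pselect (Down L lo (vt j)).
      rewrite incr_Down// !AD//; last exact: Down_seg av.
      by ring.
    have f1 : filled L lo hi (vt j) by [].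
    have f2 := filled_seg av f1.
    by rewrite incr_filled// !AF// fin//; exact: filled_near.
  - have [t Lt] : exists t, L (seg (vt j) (vt j.+1) t).
      by apply: contrapT => /forallNP.
    have n1 : near_set L (2 * h) (vt j).
      exists (seg (vt j) (vt j.+1) t) => //; have /andP[? ?] := clamp_itv t.
      by rewrite /seg /vt -natr1; split => /=; nra.
    have n2 : near_set L (2 * h) (vt j.+1).
      exists (seg (vt j) (vt j.+1) t) => //; have /andP[? ?] := clamp_itv t.
      by rewrite /seg /vt -natr1; split => /=; nra.
    rewrite incr_near// !AN// ?(ltnW jJ)// fin//; exact: near_filled_L.
rewrite -(AU _ UJ) -(AD _ D0).
rewrite -(@telescope_sumr _ 0 J (fun j => A (vt j)))//.
by apply: eq_big_nat => j /andP[_ jJ]; exact: inc.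
Qed.

Hypothesis angU : forall v, Up L hi v -> near_set L (2 * h) v -> angle_of (V v) (psiU v).
Hypothesis angD : forall v, Down L lo v -> near_set L (2 * h) v -> angle_of (V v) (psiD v).

(** Where the displacement points to the right, the determinations obtained from
    above and from below agree. *)
Lemma incr_side_east x y (J : nat) : let vt j := (x, y + j%:R * h) in
  (forall j, (j <= J)%N -> near_filled (vt j) -> 0 < (V (vt j)).1) ->
  (forall j, (j <= J)%N -> Up L hi (vt j) -> near_set L (2 * h) (vt j) ->
     `|psiU (vt j)| < pi / 2) ->
  (forall j, (j <= J)%N -> Down L lo (vt j) -> near_set L (2 * h) (vt j) ->
     `|psiD (vt j)| < pi / 2) ->
  Down L lo (vt 0%N) -> Up L hi (vt J) ->
  \sum_(0 <= j < J) incr (vt j) (vt j.+1) = psiU (vt J) - psiD (vt 0%N).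
Proof.
move=> vt pos hU hD D0 UJ.
have p0 := @pi_gt0 R.
have al_ang v : 0 < (V v).1 -> angle_of (V v) (parg (1, 0) (V v)).
  move=> v0; rewrite -[parg _ _]add0r; apply: angle_of_parg (@angle_of_east R) _.
  by rewrite /dotp [(1, 0).1]/= [(1, 0).2]/= mul1r mul0r addr0.
have eqal a v : 0 < (V v).1 -> angle_of (V v) a -> `|a| < pi / 2 -> a = parg (1, 0) (V v).
  move=> v0 va ha; apply: (angle_of_uniq va (al_ang v v0)).
  have := parg_bound (1, 0) (V v); move: ha; rewrite !ltr_norml => /andP[? ?] /andP[? ?].
  by apply/andP; split; lra.
rewrite (@incr_side x y 0 0 (fun v => parg (1, 0) (V v)) J) ?addr0//.
- by move=> j jJ nj; split; [exact: al_ang (pos j jJ nj)|rewrite subr0 parg_bound].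
- move=> j jJ Uj nj; apply: eqal; [exact: pos j jJ (near_filled_L nj)|exact: angU|exact: hU].
- move=> j jJ Uj nj; rewrite addr0; apply: eqal; [exact: pos j jJ (near_filled_L nj)|exact: angD|exact: hD].
Qed.

(** Where the displacement points to the left, the determinations obtained from
    above and from below are near [pi] and [- pi]; they differ by a full turn. *)
Lemma incr_side_west x y (J : nat) : let vt j := (x, y + j%:R * h) in
  (forall j, (j <= J)%N -> near_filled (vt j) -> (V (vt j)).1 < 0) ->
  (forall j, (j <= J)%N -> Up L hi (vt j) -> near_set L (2 * h) (vt j) ->
     `|psiU (vt j) - pi| < pi / 2) ->
  (forall j, (j <= J)%N -> Down L lo (vt j) -> near_set L (2 * h) (vt j) ->
     `|psiD (vt j) + pi| < pi / 2) ->
  Down L lo (vt 0%N) -> Up L hi (vt J) ->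
  \sum_(0 <= j < J) incr (vt j) (vt j.+1) = psiU (vt J) - (psiD (vt 0%N) + pi *+ 2).
Proof.
move=> vt pos hU hD D0 UJ.
have p0 := @pi_gt0 R.
have al_ang v : (V v).1 < 0 -> angle_of (V v) (pi + parg (-1, 0) (V v)).
  move=> v0; apply: angle_of_parg (@angle_of_west R) _.
  by rewrite /dotp [(-1, 0).1]/= [(-1, 0).2]/= mul0r addr0; lra.
have eqal a v : (V v).1 < 0 -> angle_of (V v) a -> `|a - pi| < pi / 2 -> a = pi + parg (-1, 0) (V v).
  move=> v0 va ha; apply: (angle_of_uniq va (al_ang v v0)).
  have := parg_bound (-1, 0) (V v); move: ha; rewrite !ltr_norml => /andP[? ?] /andP[? ?].
  by apply/andP; split; lra.
apply: (@incr_side x y pi (pi *+ 2) (fun v => pi + parg (-1, 0) (V v)) J) => //.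
- move=> j jJ nj; split; first exact: al_ang (pos j jJ nj).
  by rewrite addrAC subrr add0r parg_bound.
- move=> j jJ Uj nj; apply: eqal; [exact: pos j jJ (near_filled_L nj)|exact: angU|exact: hU].
- move=> j jJ Uj nj; apply: eqal; first exact: pos j jJ (near_filled_L nj).
    by apply: angle_of_add; [exact: cos2pi|exact: angD].
  by rewrite mulr2n addrA addrK; exact: hD.
Qed.

Lemma incr_top (u : nat -> R) y (I : nat) : hi < y ->
  \sum_(0 <= i < I) incr (u i, y) (u i.+1, y) = psiU (u I, y) - psiU (u 0%N, y).
Proof.
move=> yh; rewrite -(@telescope_sumr _ 0 I (fun i => psiU (u i, y)))//.
apply: eq_bigr => i _; apply: incr_Up.
- move=> t /(barrier_hi bL) /=; rewrite subrr mulr0 addr0; lra.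
- by apply: Up_high => //; exact: barrier_hi bL.
Qed.

Lemma incr_bottom (u : nat -> R) y (I : nat) : y < lo ->
  \sum_(0 <= i < I) incr (u i, y) (u i.+1, y) = psiD (u I, y) - psiD (u 0%N, y).
Proof.
move=> yh; rewrite -(@telescope_sumr _ 0 I (fun i => psiD (u i, y)))//.
apply: eq_bigr => i _; apply: incr_Down.
- move=> t /(barrier_lo bL) /=; rewrite subrr mulr0 addr0; lra.
- by apply: Down_low => //; exact: barrier_lo bL.
Qed.

End GridTurning.

(** * Fixed points of lifts *)

Section PlaneTheorem.
Context {R : realType}.
Implicit Types (u v w y z : R * R) (e r s t a b : R) (L C : set (R * R)).
Variables (F : R * R -> R * R) (D : int).
Hypothesis Fc : continuous F.
Hypothesis FD1 : forall z, F (z.1 + 1, z.2) = ((F z).1 + D%:~R, (F z).2).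

Lemma lift_translate z (n : int) :
  F (z.1 + n%:~R, z.2) = ((F z).1 + (D * n)%:~R, (F z).2).
Proof.
elim: n => [|n IH|n IH].
- by rewrite mulr0 !addr0 -!surjective_pairing.
- have := FD1 (z.1 + n%:~R, z.2); rewrite IH /= -addrA => e.
  have -> : n.+1%:~R = n%:~R + 1 :> R by rewrite intS intrD addrC.
  by rewrite e intS mulrDr mulr1 intrD -addrA [(D * n)%:~R + _]addrC.
- have := FD1 (z.1 + (- n.+1%:Z)%:~R, z.2).
  have e1 : (- n.+1%:Z)%:~R + 1 = (- n%:Z)%:~R :> R.
    have <- : - n.+1%:Z + 1 = - n%:Z by rewrite intS; ring.
    by rewrite intrD.
  rewrite /= -addrA e1 IH => -[e2 ->]; rewrite [LHS]surjective_pairing; congr pair => //.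
  apply: (addIr D%:~R); rewrite -e2 -addrA -intrD; congr (_ + _%:~R).
  by rewrite intS; ring.
Qed.

Lemma lift_bound c d : exists2 C, 0 < C & forall z, c <= z.2 <= d ->
    - C < (F z).1 - D%:~R * z.1 < C.
Proof.
have [|||e e0 h] := @strip_unif R c d (fun e z => - e^-1 < (F z).1 - D%:~R * z.1 < e^-1).
- move=> e e' x e'0 ee' /andP[h1 h2].
  have : e^-1 <= e'^-1 by rewrite lef_pV2 ?posrE//; exact: lt_le_trans ee'.
  by move=> *; apply/andP; split; lra.
- move=> z; set g := fun z => (F z).1 - D%:~R * z.1.
  have gc : continuous g.
    move=> x; apply: cvgB; first exact: (continuous_fst Fc).
    by apply: cvgM; [exact: cvg_cst|exact: cvg_fst].
  exists (`|g z| + 1)^-1; first by rewrite invr_gt0 ltr_wpDl.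
  have /cvgrPdist_lt/(_ 1 ltr01) := gc z.
  apply: filterS => y; rewrite invrK ltr_norml => /andP[h1 h2].
  have := ler_norm (g z); have := ler_norm (- g z); rewrite normrN.
  by rewrite -/(g y) => *; apply/andP; split; lra.
- move=> e z n; rewrite lift_translate /= intrM => ?.
  by have -> : (F z).1 + D%:~R * n%:~R - D%:~R * (z.1 + n%:~R) = (F z).1 - D%:~R * z.1 by ring.
- by exists e^-1; [rewrite invr_gt0|exact: h].
Qed.

Lemma lift_ucont c d e : 0 < e -> exists2 r, 0 < r & forall z w, c <= z.2 <= d ->
    close r z w -> close e (F z) (F w).
Proof.
move=> e0.
have [|||r r0 hr] := @strip_unif R c d (fun r z => forall w, close r z w -> close e (F z) (F w)).
- by move=> r r' z r'0 rr' h w [*]; apply: h; split; lra.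
- move=> z; have /continuous_closeP/(_ (e / 2)) := @Fc z.
  rewrite divr_gt0// => /(_ isT)/nbhs_closeP[r r0 hr].
  exists (r / 2); first lra.
  have r20 : 0 < r / 2 by lra.
  apply: filterS (near_close z r20) => y [? ? ? ?] w [? ? ? ?].
  have [|? ? ? ?] := hr y; first by split; lra.
  have [|? ? ? ?] := hr w; first by split; lra.
  by split; lra.
- move=> r z n h w [/= a1 a2 a3 a4].
  have := h (w.1 + (- n)%:~R, w.2).
  rewrite !lift_translate /= mulrN !rmorphN /= => -[|b1 b2 b3 b4]; first by split => /=; lra.
  by rewrite /= in b1 b2 b3 b4; split => /=; lra.
by exists r => // z w hz; exact: hr.
Qed.

(** Since [D] is not [1], the horizontal displacement grows at least like the
    abscissa, with opposite signs at the two ends of the strip. *)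
Lemma lift_drift c d : D != 1 -> exists s C : R, [/\ s = 1 \/ s = -1, 0 < C &
  forall z, c <= z.2 <= d ->
    (0 <= z.1 -> z.1 - C < s * (z - F z).1) /\
    (z.1 <= 0 -> s * (z - F z).1 < z.1 + C)].
Proof.
move=> D1; have [C C0 h] := lift_bound c d.
have [D2|D0] := ltP 1 D.
- have {D1}D2 : 2 <= D%:~R :> R by rewrite -[2]/(2%:~R) ler_int.
  exists (-1), C; split=> //; first by right.
  move=> z /h /andP[? ?]; have -> : (z - F z).1 = z.1 - (F z).1 by [].
  by split=> ?; nra.
- have {D1 D0}D2 : D%:~R <= 0 :> R.
    by rewrite -[0]/(0%:~R) ler_int -ltzD1 add0r lt_neqAle D1.
  exists 1, C; split=> //; first by left.
  move=> z /h /andP[? ?]; have -> : (z - F z).1 = z.1 - (F z).1 by [].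
  by split=> ?; nra.
Qed.

(** A displacement without zeros on the filled set is bounded away from zero in a
    neighbourhood of it: by compactness in a bounded part of the strip, and
    by [lift_drift] elsewhere. *)
Lemma filled_displacement L lo hi : barrier L lo hi -> D != 1 ->
  (forall z, filled L lo hi z -> F z <> z) ->
  exists2 rho, 0 < rho & forall z v, filled L lo hi z -> close rho z v ->
    ~ close rho (0, 0) (v - F v).
Proof.
move=> bL D1 nofix.
have Vc : continuous (fun v => v - F v : R * R) by move=> v; apply: cvgB; [exact: cvg_id|exact: Fc].
have [s [C [s1 C0 drift]]] := lift_drift (lo - 1) (hi + 1) D1.
pose Q e z := filled L lo hi z -> forall v, close e z v -> ~ close e (0, 0) (v - F v).
have [||e e0 h] := @box_unif R (- (C + 3)) (C + 3) lo hi Q.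
- move=> e e' z e'0 ee' hQ fz v c1 c2.
  exact: (hQ fz v (close_le ee' c1) (close_le ee' c2)).
- move=> z; have [Uz|nU] := pselect (Up L hi z).
    have [e e0 he] := Up_open bL Uz; exists e => //.
    by apply: filterS (near_close z e0) => y /he Uy [].
  have [Dz|nD] := pselect (Down L lo z).
    have [e e0 he] := Down_open bL Dz; exists e => //.
    by apply: filterS (near_close z e0) => y /he Uy [].
  have fz : filled L lo hi z by [].
  have [|e e0 far] := @far_ne0 R (z - F z).
    by apply: subnz => e; apply: (nofix z fz).
  have /continuous_closeP/(_ (e / 2)) := Vc z.
  rewrite divr_gt0// => /(_ isT)/nbhs_closeP[r r0 hr].
  pose m := Num.min (e / 2) (r / 2).
  have m0 : 0 < m by rewrite lt_min; apply/andP; split; lra.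
  have m1 : m <= e / 2 by rewrite ge_min lexx.
  have m2 : m <= r / 2 by rewrite ge_min lexx orbT.
  exists m => //.
  apply: filterS (near_close z m0) => y [? ? ? ?] fy v [? ? ? ?] cv.
  have zv : close r z v by split; lra.
  by apply: far; apply: close_le (close_trans cv (close_sym (hr v zv))); lra.
exists (Num.min e 1); first by rewrite lt_min e0 ltr01.
have m1 : Num.min e 1 <= e by rewrite ge_min lexx.
have m2 : Num.min e 1 <= 1 by rewrite ge_min lexx orbT.
move=> z v fz zv cv.
have /andP[zl zh] := filled_strip bL fz.
have [hz|hz] := boolP (- (C + 3) <= z.1 <= C + 3).
  have := h z hz (filled_strip bL fz) fz v; apply.
    by move: zv => [? ? ? ?]; split; lra.
  by move: cv => [? ? ? ?]; split; lra.
have [? ? ? ?] := zv.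
have [d1 d2] := drift v ltac:(apply/andP; split; lra).
move: cv => [] c1 c2 _ _; rewrite [(0, 0).1]/= in c1 c2.
have bd : - 1 < s * (v - F v).1 < 1 by case: s1 => ->; apply/andP; split; lra.
move: bd => /andP[? ?].
move: hz; rewrite negb_and -!ltNge => /orP[z1|z1].
- have := d2 ltac:(lra); lra.
- have := d1 ltac:(lra); lra.
Qed.

(** If there were no fixed point in the filled set, the turning of the
    displacement around a large rectangle would vanish by [grid_sum].  But the
    contributions of its horizontal sides are cancelled by the end values of
    its vertical sides, except for the full turn by which the sides where
    the displacement points to the left and to the right differ. *)
Theorem plane_fixed_point L lo hi : barrier L lo hi -> D != 1 ->
  (forall z, L z -> L (F z)) -> exists2 z, F z = z & filled L lo hi z.
Proof.
move=> bL D1 FL; apply: contrapT => nofix.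
have {}nofix z : filled L lo hi z -> F z <> z by move=> fz Fz; apply: nofix; exists z.
have [rho rho0 far] := filled_displacement bL D1 nofix.
have rho32 : 0 < rho / 32 by lra.
have [r r0 Fnear] := lift_ucont (lo - 1) (hi + 1) rho32.
have [eta eta0 ulc] := barrier_ulc bL r0.
have [s [C [s1 C0 drift]]] := lift_drift (lo - 1) (hi + 1) D1.
(* The mesh is the inverse of an integer: the sides of the rectangle, which lie
   at integral coordinates, then belong to the grid. *)
have [m m0 mh] : exists2 m : nat, (0 < m)%N &
    [/\ m%:R^-1 <= rho / 32, 2 * m%:R^-1 <= r, 8 * m%:R^-1 <= eta & 2 * m%:R^-1 <= 1 :> R].
  pose e := Num.min (Num.min (rho / 32) (r / 2)) (Num.min (eta / 8) (1 / 2)).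
  have e0 : 0 < e by rewrite !lt_min; do !(apply/andP; split); lra.
  have /andP[] : (e <= Num.min (rho / 32) (r / 2)) && (e <= Num.min (eta / 8) (1 / 2)).
    by rewrite -le_min.
  rewrite !le_min => /andP[? ?] /andP[? ?].
  exists (Num.truncn e^-1).+1 => //.
  have : (Num.truncn e^-1).+1%:R^-1 < e.
    by rewrite -[ltRHS]invrK ltf_pV2 ?posrE ?invr_gt0// truncnS_gt.
  by move: ((Num.truncn e^-1).+1%:R^-1 : R) => q qe; split; lra.
set h : R := m%:R^-1 in mh; case: mh => hrho hr heta h1.
have h0 : 0 < h by rewrite invr_gt0 ltr0n.
have Lstrip q : L q -> lo - 1 <= q.2 <= hi + 1.
  by move=> Lq; have := barrier_lo bL Lq; have := barrier_hi bL Lq; move=> *; apply/andP; split; lra.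
have S0 z v : filled L lo hi z -> close (2 * h) z v -> ~ close rho (0, 0) (v - F v).
  by move=> fz [? ? ? ?]; apply: (far z v fz); split; lra.
have S1 v q : L q -> close (2 * h) q v -> ~ close rho (0, 0) (v - F v).
  by move=> Lq; apply: S0; exact: filled_in.
have S2' z v : lo - 1 <= z.2 <= hi + 1 -> close (2 * h) z v -> close (rho / 32) (F z) (F v).
  by move=> hz [? ? ? ?]; apply: Fnear => //; split; lra.
have S2 v q : L q -> close (2 * h) q v -> close (rho / 32) (F q) (F v).
  by move=> /Lstrip; exact: S2'.
have S3 v w : L v -> L w -> close (8 * h) v w -> exists C,
     [/\ connected C, C `<=` L, C v, C w & forall y, C y -> close (rho / 32) (F v) (F y)].
  move=> Lv Lw vw; have [A [h1' h2' h3' h4' h5']] := ulc v w Lv Lw (close_le heta vw).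
  by exists A; split => // y Ay; apply: Fnear; [exact: Lstrip|exact: h5'].
have [psiU [angU stepU sideU]] := upper_branch bL Fc FL rho0 h0 hrho S1 S2 S3.
have [psiD [angD stepD sideD]] := lower_branch bL Fc FL rho0 h0 hrho S1 S2 S3.
pose H := (Num.truncn (Num.max hi (- lo))).+1.
have Hgt : Num.max hi (- lo) < H%:R by exact: truncnS_gt.
have [hiH loH] : hi < H%:R /\ - H%:R < lo.
  by move: Hgt; rewrite gt_max => /andP[? ?]; split; lra.
pose J := (2 * H * m)%N.
pose yt j : R := - H%:R + j%:R * h.
have mn : m%:R != 0 :> R by rewrite pnatr_eq0 -lt0n.
have ytJ : yt J = H%:R.
  by rewrite /yt /J /h !natrM -mulrA divff// mulr1; ring.
have yt0 : yt 0%N = - H%:R by rewrite /yt mul0r addr0.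
(* The vertical sides are integral translates of one column of grid points, so
   the bounds [BU] and [BD] are available before the width [M] is chosen. *)
pose sq : seq (R * R) := [seq (0, yt j) | j <- iota 0 J.+1].
have [BU hBU] := sideU sq; have [BD hBD] := sideD sq.
pose B := Num.max (Num.max BU BD) 0.
have [BUB BDB B0] : [/\ BU <= B, BD <= B & 0 <= B].
  by rewrite /B !le_max !lexx ?orbT; split.
pose M := (Num.truncn (B + C)).+1.
have MB : B + C < M%:R by exact: truncnS_gt.
pose I := (2 * M * m)%N.
pose xt i : R := - M%:R + i%:R * h.
have xtI : xt I = M%:R.
  by rewrite /xt /I /h !natrM -mulrA divff// mulr1; ring.
have xt0 : xt 0%N = - M%:R by rewrite /xt mul0r addr0.
pose inc := incr L lo hi F psiU psiD.
have sumE : \sum_(0 <= i < I) inc (xt i, yt 0%N) (xt i.+1, yt 0%N)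
   + \sum_(0 <= j < J) inc (xt I, yt j) (xt I, yt j.+1) =
  \sum_(0 <= j < J) inc (xt 0%N, yt j) (xt 0%N, yt j.+1)
   + \sum_(0 <= i < I) inc (xt i, yt J) (xt i.+1, yt J).
  apply: (@grid_sum _ (fun i j => inc (xt i, yt j) (xt i.+1, yt j))
    (fun i j => inc (xt i, yt j) (xt i, yt j.+1))) => i j _ _.
  have -> : xt i.+1 = xt i + h by rewrite /xt -natr1; ring.
  have -> : yt j.+1 = yt j + h by rewrite /yt -natr1; ring.
  exact: (@incr_square _ L lo hi F rho h psiU psiD bL).
have top : \sum_(0 <= i < I) inc (xt i, yt J) (xt i.+1, yt J) = psiU (xt I, yt J) - psiU (xt 0%N, yt J).
  by apply: (@incr_top _ L lo hi F psiU psiD bL); rewrite ytJ.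
have bot : \sum_(0 <= i < I) inc (xt i, yt 0%N) (xt i.+1, yt 0%N) = psiD (xt I, yt 0%N) - psiD (xt 0%N, yt 0%N).
  by apply: (@incr_bottom _ L lo hi F psiU psiD bL); rewrite yt0.
have upJ x : Up L hi (x, yt J) by apply: Up_high; [exact: barrier_hi bL|rewrite ytJ].
have dn0 x : Down L lo (x, yt 0%N) by apply: Down_low; [exact: barrier_lo bL|rewrite yt0].
have insq j : (j <= J)%N -> (0, yt j) \in sq.
  by move=> jJ; apply: map_f; rewrite mem_iota add0n ltnS.
have strip v : near_filled L lo hi h v -> lo - 1 <= v.2 <= hi + 1.
  exact: (near_filled_strip bL rho0 h0 hrho h1).
have nfL v : near_set L (2 * h) v -> near_filled L lo hi h v by exact: near_filled_L.
have east (n : int) : (forall j, near_filled L lo hi h (n%:~R, yt j) -> B < ((n%:~R, yt j) - F (n%:~R, yt j)).1) ->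
    \sum_(0 <= j < J) inc (n%:~R, yt j) (n%:~R, yt j.+1) = psiU (n%:~R, yt J) - psiD (n%:~R, yt 0%N).
  move=> hV; apply: (@incr_side_east _ L lo hi F rho h psiU psiD bL) => //.
  - by move=> j _ /hV; lra.
  - move=> j jJ; have := hBU (0, yt j) n (insq j jJ); rewrite /= add0r => hj Uj nj.
    apply: (hj Uj nj).1; exact: le_lt_trans BUB (hV j (nfL _ nj)).
  - move=> j jJ; have := hBD (0, yt j) n (insq j jJ); rewrite /= add0r => hj Uj nj.
    apply: (hj Uj nj).1; exact: le_lt_trans BDB (hV j (nfL _ nj)).
have west (n : int) : (forall j, near_filled L lo hi h (n%:~R, yt j) -> ((n%:~R, yt j) - F (n%:~R, yt j)).1 < - B) ->
    \sum_(0 <= j < J) inc (n%:~R, yt j) (n%:~R, yt j.+1) = psiU (n%:~R, yt J) - (psiD (n%:~R, yt 0%N) + pi *+ 2).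
  move=> hV; apply: (@incr_side_west _ L lo hi F rho h psiU psiD bL) => //.
  - by move=> j _ /hV; lra.
  - move=> j jJ; have := hBU (0, yt j) n (insq j jJ); rewrite /= add0r => hj Uj nj.
    by apply: (hj Uj nj).2; apply: (lt_le_trans (hV j (nfL _ nj))); rewrite lerN2.
  - move=> j jJ; have := hBD (0, yt j) n (insq j jJ); rewrite /= add0r => hj Uj nj.
    by apply: (hj Uj nj).2; apply: (lt_le_trans (hV j (nfL _ nj))); rewrite lerN2.
have xI : xt I = (M%:Z)%:~R by rewrite xtI.
have x0 : xt 0%N = (- M%:Z)%:~R by rewrite xt0 rmorphN.
have dr v : near_filled L lo hi h v -> (0 <= v.1 -> v.1 - C < s * (v - F v).1) /\
    (v.1 <= 0 -> s * (v - F v).1 < v.1 + C) by move=> /strip; exact: drift.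
have p0 := @pi_gt0 R.
have M0 : 0 <= M%:R :> R by [].
have dre v : near_filled L lo hi h v -> v.1 = M%:R -> B < s * (v - F v).1.
  move=> /dr[hv _] vM; rewrite vM in hv; by apply: lt_trans (hv M0); rewrite ltrBrDr.
have drw v : near_filled L lo hi h v -> v.1 = - M%:R -> s * (v - F v).1 < - B.
  move=> /dr[_ hv] vM; rewrite vM in hv; apply: lt_trans (hv _) _; first by rewrite oppr_le0.
  by rewrite ltrNr opprD opprK ltrBrDr.
have drI j (nj : near_filled L lo hi h ((M%:Z)%:~R, yt j)) := dre _ nj erefl.
have dr0 j (nj : near_filled L lo hi h ((- M%:Z)%:~R, yt j)) := drw _ nj (rmorphN _ _).
move: sumE; rewrite top bot xI x0.
case: s1 => sE; rewrite sE in drI dr0.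
- rewrite east; last by move=> j /drI; rewrite mul1r.
  rewrite west; last by move=> j /dr0; rewrite mul1r.
  by move=> sumE; lra.
- rewrite west; last by move=> j /drI; rewrite mulN1r; lra.
  rewrite east; last by move=> j /dr0; rewrite mulN1r; lra.
  by move=> sumE; lra.
Qed.

End PlaneTheorem.

(** * The universal covering of the annulus *)

Section Covering.
Context {R : realType}.
Implicit Types (u v w z : R * R) (p q : annulus R).

Definition tau : R := 2 * pi.

Lemma tau_gt0 : 0 < tau.
Proof. by rewrite mulr_gt0// pi_gt0. Qed.

Lemma cosD_int (a : R) (n : int) : cos (a + tau * n%:~R) = cos a.
Proof.
have h b : cos (b + tau) = cos b by rewrite /tau mulr_natl cosD2pi.
elim: n => [|n IH|n IH].
- by rewrite mulr0 addr0.
- by rewrite intS intrD mulrDr mulr1 [tau + _]addrC addrA h.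
- rewrite -h -addrA; have -> : tau * (- n.+1%:Z)%:~R + tau = tau * (- n%:Z)%:~R; last exact: IH.
  by rewrite intS opprD intrD mulrDr mulrN1 addrC addrA subrr add0r.
Qed.

Lemma cos_eq1_int (a : R) : cos a = 1 -> exists n : int, a = tau * n%:~R.
Proof.
move=> ca; have t0 := tau_gt0; have tn : tau != 0 by rewrite gt_eqF.
pose n := Num.floor (a / tau); exists n.
have /andP[f1 f2] := floor_itv (a / tau).
rewrite ler_pdivlMr// in f1; rewrite ltr_pdivrMr// intrD mulrDl mul1r in f2.
apply/eqP; rewrite -subr_eq0; apply/eqP; apply: cos_eq1_lt2pi.
  have := cosD_int a (- n); rewrite rmorphN mulrN => ->.
  exact: ca.
rewrite -/tau ger0_norm /n; lra.
Qed.

Definition polar z : R * R := (expR z.2 * cos (tau * z.1), expR z.2 * sin (tau * z.1)).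

Lemma angle_of_polar z : angle_of (polar z) (tau * z.1).
Proof. by exists (expR z.2); rewrite ?expR_gt0. Qed.

Lemma polar_in z : polar z \in (annulus R : set _).
Proof. by apply/mem_set; exact: angle_of_ne0 (angle_of_polar z). Qed.

Definition cover z : annulus R := exist _ (polar z) (polar_in z).

Lemma val_cover z : \val (cover z) = polar z. Proof. by []. Qed.

Lemma val_ne0 p : \val p <> (0, 0).
Proof. by case: p => x /= /set_mem. Qed.

Lemma continuous_val : continuous (fun p => \val p : R * R).
Proof. by have := @initial_continuous (annulus R) _ set_val; rewrite set_valE. Qed.

Lemma continuous_to_annulus (T : topologicalType) (g : T -> annulus R) :
  continuous (fun x => \val (g x) : R * R) -> continuous g.
Proof. by move=> h; apply: continuous_comp_initial; rewrite set_valE. Qed.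

Lemma continuous_polar : continuous polar.
Proof.
have ce : continuous (fun z => expR z.2).
  move=> z; apply: (@continuous_comp _ _ _ snd expR); first exact: cvg_snd.
  exact: continuous_expR.
have ct : continuous (fun z => tau * z.1).
  by move=> z; apply: cvgM; [exact: cvg_cst|exact: cvg_fst].
apply: continuous_plane => z; apply: cvgM; try exact: ce.
- apply: (@continuous_comp _ _ _ (fun z => tau * z.1) cos); first exact: ct.
  exact: continuous_cos.
- apply: (@continuous_comp _ _ _ (fun z => tau * z.1) sin); first exact: ct.
  exact: continuous_sin.
Qed.

Lemma continuous_cover : continuous cover.
Proof. by apply: continuous_to_annulus; exact: continuous_polar. Qed.

Definition log_height v : R := ln (dotp v v) / 2.

Lemma log_height_polar z : log_height (polar z) = z.2.
Proof.
rewrite /log_height /dotp /polar /=.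
have -> : expR z.2 * cos (tau * z.1) * (expR z.2 * cos (tau * z.1)) +
   expR z.2 * sin (tau * z.1) * (expR z.2 * sin (tau * z.1)) =
   expR z.2 ^+ 2 * (cos (tau * z.1) ^+ 2 + sin (tau * z.1) ^+ 2) by ring.
by rewrite cos2Dsin2 mulr1 lnXn ?expR_gt0// expRK -[z.2 *+ 2]mulr_natr mulfK.
Qed.

Lemma polar_log v a : angle_of v a -> polar (a / tau, log_height v) = v.
Proof.
move=> [r r0 ->]; rewrite /polar /=.
have -> : tau * (a / tau) = a by rewrite mulrC divfK// gt_eqF// tau_gt0.
have -> : log_height (r * cos a, r * sin a) = ln r.
  rewrite /log_height /dotp /=.
  have -> : r * cos a * (r * cos a) + r * sin a * (r * sin a) =
    r ^+ 2 * (cos a ^+ 2 + sin a ^+ 2) by ring.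
  by rewrite cos2Dsin2 mulr1 lnXn// -[ln r *+ 2]mulr_natr mulfK.
by rewrite lnK.
Qed.

Lemma cover_log p a : angle_of (\val p) a -> cover (a / tau, log_height (\val p)) = p.
Proof. by move=> h; apply: val_inj; rewrite /= polar_log. Qed.

Lemma cover_surj p : exists z, cover z = p.
Proof.
have [a ha] := angle_of_exists (@val_ne0 p).
by exists (a / tau, log_height (\val p)); exact: cover_log.
Qed.

Lemma cover_translate z (n : int) : cover (z.1 + n%:~R, z.2) = cover z.
Proof.
apply: val_inj; rewrite /= /polar /= mulrDr cosD_int.
by rewrite -[sin (_ + _)]opprK -cosDpihalf addrAC cosD_int cosDpihalf opprK.
Qed.

Lemma cover_inj z w : cover z = cover w -> exists n : int, w = (z.1 + n%:~R, z.2).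
Proof.
move=> /(congr1 (fun p => \val p : R * R)); rewrite /= => e.
have e2 : z.2 = w.2 by rewrite -log_height_polar e log_height_polar.
have ha := angle_of_polar z; rewrite e in ha.
have /cos_eq1_int[n hn] := angle_of_cosB (angle_of_polar w) ha.
exists n; rewrite [LHS](surjective_pairing) e2; congr pair.
apply: (@mulfI _ tau); first by rewrite gt_eqF// tau_gt0.
by rewrite mulrDr -hn addrC subrK.
Qed.

Lemma continuous_log_height (T : topologicalType) (f : T -> R * R) x :
  {for x, continuous f} -> f x <> (0, 0) -> {for x, continuous (fun y => log_height (f y))}.
Proof.
move=> fc f0; rewrite /log_height; apply: cvgM; last exact: cvg_cst.
exact: (continuous_comp (continuous_dotp fc fc) (continuous_ln (dotp_gt0_self f0))).
Qed.

(** The local inverse of [cover] through [z], defined on the half plane of points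
    whose direction is less than a right angle away from that of [polar z]. *)
Definition section_at z p : R * R :=
  (z.1 + parg (polar z) (\val p) / tau, log_height (\val p)).

Lemma section_cover z p : 0 < dotp (polar z) (\val p) -> cover (section_at z p) = p.
Proof.
move=> d0; rewrite -[RHS](cover_log (angle_of_parg (angle_of_polar z) d0)).
congr cover; rewrite /section_at; congr pair.
by rewrite mulrDl [tau * _]mulrC mulfK// gt_eqF// tau_gt0.
Qed.

Lemma section_id z : section_at z (cover z) = z.
Proof. by rewrite /section_at val_cover parg_self mul0r addr0 log_height_polar; case: z. Qed.

Lemma near_dotp_cover z : \forall p \near cover z, 0 < dotp (polar z) (\val p).
Proof.
have : {for cover z, continuous (fun p => dotp (polar z) (\val p))}.
  by apply: (@continuous_dotp _ _ (fun=> polar z)); [exact: cst_continuous|exact: continuous_val].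
move=> /(_ [set x | 0 < x]); apply.
apply: open_nbhs_nbhs; split; first exact: open_gt.
by apply: (@dotp_gt0_self _ (polar z)); exact: angle_of_ne0 (angle_of_polar z).
Qed.

Lemma continuous_section z p : 0 < dotp (polar z) (\val p) ->
  {for p, continuous (section_at z)}.
Proof.
move=> d0.
have h1 : {for p, continuous (fun q => z.1 + parg (polar z) (\val q) / tau)}.
  apply: (@continuousD _ _ _ (fun=> z.1)); first exact: cst_continuous.
  apply: (@continuousM _ _ _ (fun=> tau^-1)); last exact: cst_continuous.
  by apply: (@continuous_parg _ _ (fun=> polar z)) d0; [exact: cst_continuous|exact: continuous_val].
have h2 : {for p, continuous (fun q : annulus R => log_height (\val q))}.
  by apply: continuous_log_height; [exact: continuous_val|exact: val_ne0].
exact: (cvg_pair h1 h2).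
Qed.

Lemma near_section z e : 0 < e -> \forall p \near cover z,
  close e z (section_at z p) /\ cover (section_at z p) = p.
Proof.
move=> e0; have h := near_dotp_cover z.
have /continuous_section/continuous_closeP/(_ e e0) := nbhs_singleton h.
rewrite section_id => h2.
near=> p; split; first by near: p.
by apply: section_cover; near: p.
Unshelve. all: by end_near. Qed.

Lemma cover_lift (g : R * R -> annulus R) : continuous g ->
  exists2 G : R * R -> R * R, continuous G & forall z, cover (G z) = g z.
Proof.
move=> gc; pose u z : R * R := \val (g z).
have uc : continuous u by move=> z; apply: (continuous_comp (gc z)); exact: continuous_val.
have [th [thc thP]] := @plane_lift R u uc (fun z => @val_ne0 (g z)).
exists (fun z => (th z / tau, log_height (u z))); last by move=> z; exact: (@cover_log (g z) _ (thP z)).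
apply: continuous_plane => z.
  by apply: cvgM; [exact: thc|exact: cvg_cst].
by apply: continuous_log_height; [exact: uc|exact: val_ne0].
Qed.

(** Two lifts of one map differ by a locally constant deck translation. *)
Lemma cover_lift_const (T : topologicalType) (C : set T) (G H : T -> R * R) :
  connected C -> continuous G -> continuous H -> (forall x, C x -> cover (G x) = cover (H x)) ->
  forall x y, C x -> C y -> G x - H x = G y - H y.
Proof.
move=> cC Gc Hc GH x y Cx Cy.
have e2 t : C t -> (G t).2 = (H t).2 by move=> Ct; have [n ->] := cover_inj (GH t Ct).
have h := @connected_cos1_const R T C (fun t => tau * ((G t).1 - (H t).1)) cC.
have e : tau * ((G x).1 - (H x).1) = tau * ((G y).1 - (H y).1).
  apply: h => //.
    apply: continuous_subspaceT => t; apply: cvgM; first exact: cvg_cst.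
    by apply: cvgB; [exact: (continuous_fst Gc)|exact: (continuous_fst Hc)].
  move=> t Ct; have [n hn] := cover_inj (GH t Ct).
  rewrite hn /= opprD addrA subrr add0r mulrN cosN -[_ * _]add0r cosD_int cos0//.
move/mulfI : e; rewrite gt_eqF ?tau_gt0// => /(_ isT) e1.
rewrite [LHS]surjective_pairing [RHS]surjective_pairing; congr pair => //=.
by rewrite (e2 x Cx) (e2 y Cy) !subrr.
Qed.

Lemma curve_cover_lift (c : R -> annulus R) z : curve c -> cover z = c 0 ->
  exists u : R -> R * R, [/\ curve u, forall t, cover (u t) = c t & u 0 = z].
Proof.
move=> cc z0; pose v t : R * R := \val (c t).
have vc : curve v by exact: (curve_comp continuous_val cc).
have a0 : angle_of (v 0) (tau * z.1) by rewrite /v -z0; exact: angle_of_polar.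
have [th [h1 h2 h3]] := curve_lift vc (fun t => @val_ne0 (c t)) a0.
exists (fun t => (th t / tau, log_height (v t))); split.
- apply: curve_pair.
    split; last by move=> t; rewrite h1.2.
    by move=> t; apply: cvgM; [exact: h1.1|exact: cvg_cst].
  split; last by move=> t; rewrite vc.2.
  by move=> t; apply: continuous_log_height; [exact: vc.1|exact: val_ne0].
- by move=> t; exact: (@cover_log (c t) _ (h2 t)).
- rewrite h3 /v -z0 val_cover log_height_polar mulrC mulKf ?gt_eqF ?tau_gt0//.
  by case: (z).
Qed.

End Covering.

(** * Displacements of paths and lifts of self-maps *)

Section Displacement.
Context {R : realType}.
Implicit Types (u v w z : R * R) (p q : annulus R) (a b g : R -> annulus R).

Definition path_lift a (u : R -> R * R) : Prop :=
  curve u /\ forall t, cover (u t) = a (clamp t).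

(** The net displacement of the lifts of [a]; for loops this is the element of
    the fundamental group, seen as a deck translation. *)
Definition displacement a v : Prop := exists2 u, path_lift a u & u 1 - u 0 = v.

Lemma path_lift_exists a z : {within `[0, 1], continuous a} -> cover z = a 0 ->
  exists2 u, path_lift a u & u 0 = z.
Proof.
move=> /curve_clamp ac z0.
have [|u [h1 h2 h3]] := curve_cover_lift ac (z := z); first by rewrite /= clamp0.
by exists u.
Qed.

Lemma path_lift_diff a (u u' : R -> R * R) : path_lift a u -> path_lift a u' ->
  forall s t, u s - u' s = u t - u' t.
Proof.
move=> [uc uE] [uc' uE'] s t.
apply: (cover_lift_const (@connected_setTR R) uc.1 uc'.1) => // x _.
by rewrite uE uE'.
Qed.

Lemma displacement_uniq a v w : displacement a v -> displacement a w -> v = w.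
Proof.
move=> [u hu <-] [u' hu' <-]; have := path_lift_diff hu hu' 1 0.
move=> e; apply/eqP; rewrite -subr_eq0.
have -> : u 1 - u 0 - (u' 1 - u' 0) = (u 1 - u' 1) - (u 0 - u' 0).
  by rewrite !opprD !opprK addrACA.
by rewrite e subrr.
Qed.

Lemma path_lift_translate a (u : R -> R * R) (n : int) : path_lift a u ->
  path_lift a (fun t => ((u t).1 + n%:~R, (u t).2)).
Proof.
move=> [uc uE]; split; last by move=> t; rewrite cover_translate.
apply: curve_pair; last exact: curve_snd.
by apply: curveD; [exact: curve_fst|exact: curve_cst].
Qed.

Lemma path_cat0 (T : topologicalType) (c e : R -> T) : path_cat c e 0 = c 0.
Proof. by rewrite /path_cat invr_ge0 ler0n mulr0. Qed.

Lemma path_cat1 (T : topologicalType) (c e : R -> T) : path_cat c e 1 = e 1.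
Proof.
rewrite /path_cat; have -> : (1 <= 2^-1 :> R) = false by apply/negbTE; rewrite -ltNge; lra.
by congr e; lra.
Qed.

Lemma displacement_cat a b v w : a 1 = b 0 -> displacement a v -> displacement b w ->
  displacement (path_cat a b) (v + w).
Proof.
move=> ab [ua [uac uaE] <-] [ub hub <-].
have : cover (ub 0) = cover (ua 1) by rewrite hub.2 uaE clamp0 clamp1.
move=> /cover_inj[n hn].
have [ubc ubE] := path_lift_translate n hub.
set ub' := (fun t => _) in ubc ubE.
have u10 : ua 1 = ub' 0 by rewrite hn.
have d : ub 1 - ub 0 = ub' 1 - ub' 0.
  rewrite [LHS]surjective_pairing [RHS]surjective_pairing /ub' /=; congr pair.
  by ring.
exists (ccat ua ub'); last by rewrite ccat0// ccat1 d u10 [RHS]addrC addrA subrK.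
split; first exact: curve_ccat.
have hc := curve_ccat uac ubc.
move=> t; rewrite hc.2; have /andP[t0 t1] := clamp_itv t.
move: (clamp t) t0 t1 => s s0 s1; rewrite /path_cat; case: ifPn => [s2|].
  rewrite ccat_l// uaE clampK clamp_id//; apply/andP; split; lra.
rewrite -ltNge => s2; rewrite ccat_r ?ltW// ubE clampK clamp_id//; apply/andP; split; lra.
Qed.

Lemma displacement_rev a v : displacement a v -> displacement (path_rev a) (- v).
Proof.
move=> [u [uc uE] <-]; exists (fun t => u (1 - clamp t)).
  split; first exact: curve_rev.
  move=> t; rewrite uE /path_rev; congr a; rewrite clamp_id//.
  by have /andP[? ?] := clamp_itv t; apply/andP; split; lra.
by rewrite clamp0 clamp1 subr0 subrr opprB.
Qed.

Lemma displacement_cst p : displacement (cst p) 0.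
Proof.
have [z hz] := cover_surj p; exists (fun=> z); last by rewrite subrr.
by split; [exact: curve_cst|move=> t].
Qed.

Lemma displacement_iter a g v n : a 1 = a 0 -> g = cst (a 0) -> displacement a v ->
  displacement (iter n (path_cat a) g) (v *+ n) /\ iter n (path_cat a) g 0 = a 0.
Proof.
move=> a10 -> da; elim: n => [|n [IH1 IH2]] /=.
  by rewrite mulr0n; split => //; exact: displacement_cst.
split; last by rewrite path_cat0.
by rewrite mulrS; apply: displacement_cat => //; rewrite IH2.
Qed.

Lemma displacement_pow g v (m : int) : g 1 = g 0 -> displacement g v ->
  displacement (loop_pow g m) (v *~ m).
Proof.
move=> g10 dg; case: m => n.
  by have [] := displacement_iter n g10 erefl dg.
have r0 : path_rev g 0 = g 0 by rewrite /path_rev subr0.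
have r1 : path_rev g 1 = g 0 by rewrite /path_rev subrr.
have [] := @displacement_iter (path_rev g) (cst (g 0)) (- v) n.+1 _ _ (displacement_rev dg).
- by rewrite r0 r1.
- by rewrite r0.
- by rewrite mulNrn.
Qed.

Lemma continuous_clamp2 (T : topologicalType) (H : R * R -> T) :
  {within `[0, 1] `*` `[0, 1], continuous H} ->
  continuous (fun z => H (clamp z.1, clamp z.2)).
Proof.
move=> /subspace_sigL_continuousP Hc.
have hin (z : R * R) : (clamp z.1, clamp z.2) \in (`[0, 1] `*` `[0, 1] : set (R * R)).
  by apply/mem_set; split; rewrite /= in_itv /= clamp_itv.
have h : continuous (fun z : R * R =>
    (exist (fun x => x \in (`[0, 1] `*` `[0, 1] : set (R * R))) _ (hin z) :
       (`[0, 1] `*` `[0, 1] : set (R * R)))).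
  apply: continuous_comp_initial; rewrite set_valE.
  apply: continuous_plane => z.
    by apply: (@continuous_comp _ _ _ fst clamp); [exact: cvg_fst|exact: continuous_clamp].
  by apply: (@continuous_comp _ _ _ snd clamp); [exact: cvg_snd|exact: continuous_clamp].
by move=> z; exact: (continuous_comp (h z) (Hc _)).
Qed.

(** Lift the homotopy.  The two sides on which it is constant lift to curves over
    single points, hence to constant curves, so the lifts of both paths have the same end
    points. *)
Lemma displacement_homotopic a b v w : path_homotopic a b ->
  displacement a v -> displacement b w -> v = w.
Proof.
move=> [H [Hc H0 H1 Hs]] da db.
have [G Gc GH] := cover_lift (continuous_clamp2 Hc).
have in01 (t : R) : clamp t \in `[0, 1] by rewrite in_itv /= clamp_itv.
have sl1 s : curve (fun t => G (clamp s, clamp t)).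
  split; last by move=> t; rewrite clampK.
  move=> t; apply: (@continuous_comp _ _ _ (fun t => (clamp s, clamp t)) G); last exact: Gc.
  exact: (cvg_pair (@cst_continuous _ _ _ t) (@continuous_clamp R t)).
have sl2 t : continuous (fun s => G (clamp s, clamp t)).
  move=> s; apply: (@continuous_comp _ _ _ (fun s => (clamp s, clamp t)) G); last exact: Gc.
  exact: (cvg_pair (@continuous_clamp R s) (@cst_continuous _ _ _ s)).
have da' : displacement a (G (clamp 0, clamp 1) - G (clamp 0, clamp 0)).
  exists (fun t => G (clamp 0, clamp t)) => //; split => // t.
  by rewrite GH /= !clampK clamp0 H0.
have db' : displacement b (G (clamp 1, clamp 1) - G (clamp 1, clamp 0)).
  exists (fun t => G (clamp 1, clamp t)) => //; split => // t.
  by rewrite GH /= !clampK clamp1 H1.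
have e (t : R) : t = 0 \/ t = 1 -> G (clamp 0, clamp t) = G (clamp 1, clamp t).
  move=> ht; have := @cover_lift_const _ _ setT (fun s => G (clamp s, clamp t)) (fun=> G (clamp 0, clamp t))
    (@connected_setTR R) (sl2 t) (@cst_continuous _ _ _) _ 1 0 I I.
  rewrite subrr => h; apply/esym/eqP; rewrite -subr_eq0; apply/eqP; apply: h.
  move=> s _; rewrite !GH /= !clampK; have [hs0 hs1] := Hs _ (in01 s).
  have z01 : (0 : R) \in `[0, 1] by rewrite in_itv /= lexx ler01.
  have [g0 g1] := Hs 0 z01.
  by case: ht => ->; rewrite ?clamp0 ?clamp1 ?hs0 ?hs1 ?g0 ?g1.
rewrite (displacement_uniq da da') (displacement_uniq db db').
by rewrite (e 0) ?(e 1)//; [right|left].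
Qed.

Definition self_lift (f : annulus R -> annulus R) (F : R * R -> R * R) (d : int) : Prop :=
  [/\ continuous F, forall z, cover (F z) = f (cover z) &
      forall z, F (z.1 + 1, z.2) = ((F z).1 + d%:~R, (F z).2)].

Lemma path_lift_is_path (u : R -> R * R) : curve u ->
  is_path (cover (u 0)) (cover (u 1)) (fun t => cover (u t)).
Proof.
move=> [uc uE]; split => //; apply: continuous_subspaceT => t.
by apply: (continuous_comp (uc t)); exact: continuous_cover.
Qed.

Lemma path_lift_cover (u : R -> R * R) : curve u -> path_lift (fun t => cover (u t)) u.
Proof. by move=> [uc uE]; split => // t; rewrite -uE. Qed.

(** Apply the degree hypothesis at [cover z] to the generating loop through it,
    with the projection of the segment from [z] to [F z] as connecting path: the
    displacements of that path cancel, leaving [F (z + 1) - F z] on one side and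
    [d] times the unit translation on the other. *)
Lemma self_lift_exists f d : continuous f -> has_degree f d -> exists F, self_lift f F d.
Proof.
move=> fc fd.
have fcc : continuous (fun z => f (cover z)).
  by move=> z; apply: (continuous_comp (@continuous_cover _ z)); exact: fc.
have [F Fc FE] := cover_lift fcc.
exists F; split=> // z.
pose z' := (z.1 + 1, z.2) : R * R.
have cz' : cover z' = cover z by rewrite -(cover_translate z 1).
have ca := curve_seg z (F z); have cg := curve_seg z z'.
pose a t := cover (seg z (F z) t); pose g t := cover (seg z z' t).
have pa : is_path (cover z) (f (cover z)) a.
  by have := path_lift_is_path ca; rewrite seg0 seg1 FE.
have pg : is_path (cover z) (cover z) g.
  by have := path_lift_is_path cg; rewrite seg0 seg1 cz'.
have da : displacement a (F z - z).
  by exists (seg z (F z)); [exact: path_lift_cover|rewrite seg0 seg1].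
have dg : displacement g (1, 0).
  exists (seg z z'); first exact: path_lift_cover.
  rewrite seg0 seg1 [LHS]surjective_pairing /=; congr pair; last exact: subrr.
  by rewrite addrAC subrr add0r.
have dfg : displacement (f \o g) (F z' - F z).
  exists (fun t => F (seg z z' t)); last by rewrite seg0 seg1.
  split; first exact: (curve_comp Fc cg).
  by move=> t; rewrite FE /= /g; rewrite -(curve_seg z z').2.
have h := displacement_homotopic (fd _ _ _ pa pg).
have e1 : a 1 = (f \o g) 0 by rewrite /= /a /g seg0 seg1 FE.
have e2 : path_cat a (f \o g) 1 = path_rev a 0.
  by rewrite path_cat1 /path_rev /= subr0 /a /g !seg1 FE cz'.
have dl := displacement_cat e2 (displacement_cat e1 da dfg) (displacement_rev da).
have g10 : g 1 = g 0 by rewrite /g seg0 seg1.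
have := h _ _ dl (displacement_pow d g10 dg).
rewrite addrAC subrr add0r => /eqP; rewrite subr_eq => /eqP ->.
rewrite [LHS]surjective_pairing.
have -> : (1, 0) *~ d = (d%:~R, 0) :> R * R.
  have en n : (1, 0) *+ n = (n%:R, 0) :> R * R.
    by elim: n => [//|n IH]; rewrite !mulrS IH; congr pair; rewrite addr0.
  case: d {fd h} => n; first by rewrite -!pmulrn en.
  by rewrite !NegzE !mulrNz -!pmulrn en; congr pair; rewrite oppr0.
by rewrite /= add0r addrC.
Qed.

Lemma self_lift_iter f F d n : self_lift f F d -> self_lift (iter n f) (iter n F) (d ^+ n).
Proof.
move=> [Fc FE FD]; elim: n => [|n [IH1 IH2 IH3]] /=.
  split => //; first by move=> z; exact: cvg_id.
- split=> [z|z|z].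
  + by apply: (continuous_comp (IH1 z)); exact: Fc.
  + by rewrite FE IH2.
  + by rewrite iterS IH3 (lift_translate FD) -exprS.
Qed.

End Displacement.

(** * The preimage of an essential continuum *)

Section EssentialContinuum.
Context {R : realType}.
Implicit Types (u v w z : R * R) (p q : annulus R).

Lemma connected_locally_constant (T : topologicalType) (K B : set T) :
  connected K -> (forall x, K x -> \forall y \near x, K y -> B x <-> B y) ->
  K `&` B !=set0 -> K `<=` B.
Proof.
move=> cK loc K0 p Kp.
suff e : K `&` B = K by have [] : (K `&` B) p by rewrite e.
apply: cK => //.
- exists (interior [set q | K q -> B q]); first exact: open_interior.
  apply/seteqP; split => q [Kq] => [Bq|/nbhs_singleton /= h]; last by split => //; exact: h.
  split => //; apply: filterS (loc q Kq) => x h Kx; exact/h.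
- exists (~` interior [set q | K q -> ~ B q]).
    by apply: open_closedC; exact: open_interior.
  apply/seteqP; split => q [Kq] => [Bq|/= h].
    by split => // /nbhs_singleton /= h; exact: h.
  split => //; apply: contrapT => nBq; apply: h.
  by apply: filterS (loc q Kq) => x h Kx Bx; apply: nBq; exact/h.
Qed.

Lemma int_lt1 (n : int) : -1 < (n%:~R : R) < 1 -> n = 0.
Proof.
move=> /andP[a b]; have {}a : ((-1)%:~R < n%:~R :> R) by rewrite rmorphN.
have {}b : (n%:~R < (1 : int)%:~R :> R) by [].
by rewrite !ltr_int in a b; case: n a b => [[|n]|n].
Qed.

Lemma connected_between (T : topologicalType) (A B : set T) :
  connected A -> A `<=` B -> B `<=` closure A -> connected B.
Proof.
move=> cA AB BA; apply/connectedP => E [E0 BE sE].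
wlog AE : E E0 BE sE / A `<=` E false.
  move=> wl; have [] := connected_subset sE _ cA; first by rewrite -BE.
    exact: wl.
  move=> AE; apply: (wl (E \o negb)) => //.
  - by case=> /=.
  - by rewrite BE setUC.
  - by rewrite separatedC.
have [y Ey] := E0 true.
have : closure (E false) y by apply: (closureS AE); apply: BA; rewrite BE; right.
by move=> Cy; have [+ _] := sE; apply/eqP/set0P; exists y.
Qed.

Variable K : set (annulus R).
Hypotheses (cK : continuum K) (lcK : locally_connected K) (eK : essential K).

Definition lifted : set (R * R) := [set z | K (cover z)].

Let height p : R := log_height (\val p).

Lemma continuous_height : continuous height.
Proof. by move=> p; apply: continuous_log_height; [exact: continuous_val|exact: val_ne0]. Qed.

Lemma lifted_closed : closed lifted.
Proof.
have [_ Kc _] := cK.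
pose vl (p : annulus R) : R * R := \val p.
have cV : compact [set vl p | p in K].
  apply: continuous_compact Kc; apply: continuous_subspaceT; exact: continuous_val.
have clV := compact_closed (@norm_hausdorff _ _) cV.
have -> : lifted = polar @^-1` [set vl p | p in K].
  apply/seteqP; split => z /=; first by move=> Kz; exists (cover z).
  by move=> [p Kp pz]; rewrite /lifted /=; have <- : p = cover z by exact: val_inj.
by apply: closed_comp clV => z _; exact: continuous_polar.
Qed.

Lemma lifted_translate z (n : int) : lifted z -> lifted (z.1 + n%:~R, z.2).
Proof. by rewrite /lifted /= cover_translate. Qed.

Lemma lifted_translateE z (n : int) : lifted (z.1 + n%:~R, z.2) <-> lifted z.
Proof. by rewrite /lifted /= cover_translate. Qed.

Lemma lifted_lowest : exists2 z, lifted z & forall w, lifted w -> z.2 <= w.2.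
Proof.
have [K0 Kc _] := cK.
have [|p Kp hp] := @compact_EVT_min _ _ height _ K0 Kc.
  apply: continuous_subspaceT; exact: continuous_height.
have [z zp] := cover_surj p; exists z; first by rewrite /lifted /= zp; exact/set_mem.
move=> w Kw; have := hp _ (mem_set Kw).
by rewrite -zp /height !val_cover !log_height_polar.
Qed.

Lemma lifted_highest : exists2 z, lifted z & forall w, lifted w -> w.2 <= z.2.
Proof.
have [K0 Kc _] := cK.
have [|p Kp hp] := @compact_EVT_max _ _ height _ K0 Kc.
  apply: continuous_subspaceT; exact: continuous_height.
have [z zp] := cover_surj p; exists z; first by rewrite /lifted /= zp; exact/set_mem.
move=> w Kw; have := hp _ (mem_set Kw).
by rewrite -zp /height !val_cover !log_height_polar.
Qed.

Lemma lifted_conn (P : set (R * R)) :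
  (forall z, lifted z -> P z -> P (z.1 + 1, z.2)) ->
  (forall z, lifted z -> P z -> P (z.1 - 1, z.2)) ->
  (forall z, lifted z -> exists2 e, 0 < e &
     forall w, lifted w -> close e z w -> P z <-> P w) ->
  (exists2 z, lifted z & P z) -> forall z, lifted z -> P z.
Proof.
move=> hs hp loc [z0 Lz0 Pz0].
have tr z (n : int) : lifted z -> P z -> P (z.1 + n%:~R, z.2).
  move=> Lz Pz; elim: n => [|n IH|n IH].
  - by rewrite addr0 -surjective_pairing.
  - have := hs _ (lifted_translate n Lz) IH.
    by rewrite /= -addrA intS intrD [1 + _]addrC.
  - have := hp _ (lifted_translate (- n%:Z) Lz) IH.
    by rewrite /= -addrA intS opprD intrD [(- 1)%:~R + _]addrC.
have eqv z w : lifted z -> cover z = cover w -> P z -> P w.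
  by move=> Lz /cover_inj[n ->]; exact: tr.
pose B := [set p | exists2 z, cover z = p & P z].
have KB : K `<=` B.
  have [_ _ Kcon] := cK; apply: (connected_locally_constant Kcon); last first.
    by exists (cover z0); split => //; exists z0.
  move=> p Kp; have [z zp] := cover_surj p.
  have Lz : lifted z by rewrite /lifted /= zp.
  have [e e0 he] := loc z Lz; rewrite -zp.
  apply: filterS (near_section z e0) => q [zq qE] Kq.
  have Lq : lifted (section_at z q) by rewrite /lifted /= qE.
  have h := he _ Lq zq; split=> -[w wE Pw].
    exists (section_at z q) => //; apply/h; apply: (eqv w z _ wE Pw).
    by rewrite /lifted /= wE; exact: Lz.
  exists z => //; apply/h; apply: (eqv w _ _ _ Pw); first by rewrite /lifted /= wE.
  by rewrite wE qE.
move=> z Lz; have [w wz Pw] := KB _ Lz.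
by apply: (eqv w z _ wz Pw); rewrite /lifted /= wz; exact: Lz.
Qed.

(** A small connected open part of [K] near [cover z] is carried by [section_at z]
    into [lifted].  A lift of one of its points which is near [z] agrees with the
    one given by the section, since two lifts differ by an integer. *)
Lemma lifted_ulc e : 0 < e -> exists2 r, 0 < r &
  forall v w, lifted v -> lifted w -> close r v w ->
  exists C, [/\ connected C, C `<=` lifted, C v, C w & forall y, C y -> close e v y].
Proof.
move=> e0.
pose Q r v := forall w, lifted v -> lifted w -> close r v w ->
  exists C, [/\ connected C, C `<=` lifted, C v, C w & forall y, C y -> close e v y].
have [zlo Llo lo] := lifted_lowest; have [zhi Lhi hi] := lifted_highest.
have [|||r r0 h] := @strip_unif R zlo.2 zhi.2 Q.
- by move=> r r' v r'0 rr' hQ w Lv Lw vw; apply: hQ => //; exact: close_le vw.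
- move=> z; have [Lz|nLz] := pselect (lifted z); last first.
    have : nbhs z (~` lifted).
      by apply: open_nbhs_nbhs; split => //; apply: closed_openC; exact: lifted_closed.
    move=> nz; exists 1 => //; apply: filterS nz => v nLv w Lv; by [].
  (* Two points within [1 / 4] of [z] which differ by an integer are equal. *)
  pose e' := Num.min (e / 2) (1 / 4).
  have e'0 : 0 < e' by rewrite lt_min; apply/andP; split; lra.
  have e'1 : e' <= e / 2 by rewrite ge_min lexx.
  have e'2 : e' <= 1 / 4 by rewrite ge_min lexx orbT.
  pose U : set (annulus R) := interior ([set q : annulus R | 0 < dotp (polar z) (\val q) /\ close e' z (section_at z q)] : set (annulus R)).
  have Uz : U (cover z).
    by apply: filterS2 (near_dotp_cover z) (near_section z e'0) => q ? [].
  have [W [oW Wz WU cW]] := lcK Lz (open_interior _) Uz.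
  have WU' q : K q -> W q -> 0 < dotp (polar z) (\val q) /\ close e' z (section_at z q).
    by move=> Kq Wq; have /nbhs_singleton := WU _ (conj Kq Wq).
  pose C := [set section_at z q | q in K `&` W].
  have cC : connected C.
    apply: connected_continuous_connected => //.
    apply/subspace_continuousP => q [Kq Wq].
    apply: cvg_within_filter; apply: continuous_section; exact: (WU' q Kq Wq).1.
  have CL : C `<=` lifted.
    move=> _ [q [Kq Wq] <-]; rewrite /lifted /= section_cover//; exact: (WU' q Kq Wq).1.
  have CE y : C y -> close e' z y by move=> [q [Kq Wq] <-]; exact: (WU' q Kq Wq).2.
  have : \forall v \near z, W (cover v) /\ close e' z v.
    have nW : \forall v \near z, W (cover v).
      by apply: (@continuous_cover R z); apply: open_nbhs_nbhs.
    by apply: filterS2 nW (near_close z e'0).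
  move=> /nbhs_closeP[r r0 hr].
  have bnd (a b x : R) : z.1 - e' < a -> a < z.1 + e' -> z.1 - e' < b -> b < z.1 + e' ->
      a = b + x -> -1 < x < 1.
    by move=> *; apply/andP; split; lra.
  have inC v : lifted v -> close r z v -> C v.
    move=> Lv /hr[Wv [v1 v2 v3 v4]]; exists (cover v) => //.
    have [d0 [s1 s2 s3 s4]] := WU' (cover v) Lv Wv.
    have [n hn] := cover_inj (section_cover d0).
    rewrite {2}hn; set s := section_at z (cover v) in hn s1 s2 s3 s4 *.
    suff -> : n = 0 by rewrite addr0 -surjective_pairing.
    have vn : v.1 = s.1 + n%:~R by rewrite hn.
    have n1 := bnd _ _ _ v1 v2 s1 s2 vn.
    exact: int_lt1.
  exists (r / 2); first lra.
  have r20 : 0 < r / 2 by lra.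
  apply: filterS (near_close z r20) => v zv w Lv Lw vw.
  have Cv : C v by apply: inC => //; apply: close_le zv; lra.
  have Cw : C w by apply: inC => //; apply: close_le (close_trans zv vw); lra.
  exists C; split => // y Cy; apply: close_le (close_trans (close_sym (CE _ Cv)) (CE _ Cy)); lra.
- move=> r z n hQ w Lz Lw [/= c1 c2 c3 c4].
  have [||| C [cC CL Cz Cw CE]] := hQ (w.1 + (- n)%:~R, w.2).
  + exact/lifted_translateE/Lz.
  + exact: lifted_translate.
  + by rewrite rmorphN; split => /=; lra.
  exists [set (y.1 + n%:~R, y.2) | y in C]; split.
  + apply: connected_continuous_connected => //; apply: continuous_subspaceT.
    apply: continuous_plane => y; last exact: cvg_snd.
    by apply: cvgD; [exact: cvg_fst|exact: cvg_cst].
  + by move=> _ [y Cy <-]; apply: lifted_translate; exact: CL.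
  + by exists z.
  + by exists (w.1 + (- n)%:~R, w.2) => //=; rewrite rmorphN subrK -surjective_pairing.
  + by move=> _ [y /CE[? ? ? ?] <-]; split => /=; lra.
exists r => // v w Lv Lw vw; apply: h => //.
by rewrite lo ?hi.
Qed.

Lemma polar_norm z : (\val (cover z) : R * R).1 ^+ 2 + (\val (cover z) : R * R).2 ^+ 2 = expR z.2 ^+ 2.
Proof.
rewrite /= !exprMn -mulrDr cos2Dsin2 mulr1//.
Qed.

(** Such a path, extended by vertical half lines, projects to a connected set in
    the complement of [K] whose closure contains both ends of the annulus. *)
Lemma lifted_sep (c : R -> R * R) lo hi : curve c -> (forall t, ~ lifted (c t)) ->
  (forall w, lifted w -> lo <= w.2 <= hi) -> (c 0).2 < lo -> hi < (c 1).2 -> False.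
Proof.
move=> [cc cE] cL hL c0 c1.
(* Outside the unit interval [c] is constant, and [e] is a vertical half line. *)
pose e t : R * R := ((c t).1, (c t).2 + (t - clamp t)).
have ec : continuous e.
  apply: continuous_plane; first exact: continuous_fst.
  move=> t; apply: cvgD; first exact: (continuous_snd cc).
  by apply: cvgB; [exact: cvg_id|exact: continuous_clamp].
have eL t : ~ lifted (e t).
  have [t0|t0] := leP t 0.
    move=> /hL /andP[+ _]; rewrite /e /= cE (clamp_le0 t0); lra.
  have [t1|t1] := leP 1 t.
    move=> /hL /andP[_]; rewrite /e /= cE (clamp_ge1 t1); lra.
  rewrite /e clamp_id ?ltW//= subrr addr0 -surjective_pairing; exact: cL.
pose h t := to_ends_compactification (cover (e t)).
have hc : continuous h.
  have sc := @one_point_compactification_some_continuous (R * R)%type.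
  move=> t; apply: (@continuous_comp _ _ _ e (fun z => to_ends_compactification (cover z))); first exact: ec.
  by move: (e t) => z; exact: (continuous_comp (@continuous_polar R z) (sc _)).
pose S := range h.
have cS : connected S.
  apply: connected_continuous_connected; first exact: connected_setTR.
  exact: continuous_subspaceT.
pose E := ~` (@to_ends_compactification R @` K).
pose T : set (one_point_compactification (R * R)%type) := S `|` [set Some (0, 0); None].
have SE : S `<=` E.
  move=> _ [t _ <-] [p Kp] pe; have {}pe : p = cover (e t) by apply: val_inj; case: pe.
  by apply: (eL t); rewrite /lifted /= -pe.
have TE : T `<=` E.
  move=> x [/SE//|[->|->]] [p Kp] //= -[] pe.
  exact: (@val_ne0 _ p).
have TS : T `<=` closure S.
  move=> x [Sx|[->|->]]; first exact: subset_closure.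
  - move=> A nA; have /nbhs_closeP[r r0 hr] : nbhs (0, 0) (Some @^-1` A) by exact: nA.
    pose t := Num.min 0 (ln r - (c 0).2 - 1).
    have t0 : t <= 0 by rewrite ge_min lexx.
    have t1 : t <= ln r - (c 0).2 - 1 by rewrite ge_min lexx orbT.
    exists (h t); split; first by exists t.
    apply: hr.
    have e2 : expR (e t).2 < r.
      rewrite -[ltRHS](@lnK _ r) ?posrE// ltr_expR /e /= cE (clamp_le0 t0); lra.
    have e3 := expR_gt0 (e t).2.
    suff : close r (0, 0) (polar (e t)) by [].
    have := cos_geN1 (tau * (e t).1); have := cos_le1 (tau * (e t).1).
    have := sin_geN1 (tau * (e t).1); have := sin_le1 (tau * (e t).1).
    rewrite /polar; move: (cos _) (sin _) (expR _) e2 e3 => a b E' e2 e3 k1 k2 k3 k4.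
    by split => /=; nra.
  - move=> A [C [Cc Ccl] CA].
    have [m hm] : exists m, forall v, C v -> dotp v v <= m.
      have [C0|C0] := pselect (C !=set0); last by exists 0 => v Cv; case: C0; exists v.
      have [|v Cv hv] := @compact_EVT_max _ _ (fun v => dotp v v) C C0 Cc.
        apply: continuous_subspaceT => v; apply: continuous_dotp; exact: cvg_id.
      by exists (dotp v v) => w Cw; apply: hv; exact: mem_set.
    pose t := Num.max 1 (`|m| + 2 - (c 1).2).
    have t1 : 1 <= t by rewrite le_max lexx.
    have t2 : `|m| + 2 - (c 1).2 <= t by rewrite le_max lexx orbT.
    exists (h t); split; first by exists t.
    apply: CA; left; exists (polar (e t)) => // /hm.
    have -> : dotp (polar (e t)) (polar (e t)) = expR (e t).2 ^+ 2.
      by rewrite -(polar_norm (e t)) /dotp !expr2.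
    have h1 := expR_ge1Dx (e t).2.
    have h2 : `|m| + 1 <= (e t).2 by rewrite /e /= cE (clamp_ge1 t1); lra.
    have h3 := ler_norm m; have h4 := normr_ge0 m.
    by move: (expR _) h1 => E' h1; nra.
have cT : connected T by apply: connected_between cS _ TS; move=> x Sx; left.
apply: eK; apply: same_connected_component; exists T; last by right; right.
by split => //; right; left.
Qed.

Lemma lifted_barrier : exists lo hi, barrier lifted lo hi.
Proof.
have [zlo Llo lo] := lifted_lowest; have [zhi Lhi hi] := lifted_highest.
exists zlo.2, zhi.2; split => //.
- exact: lifted_closed.
- by move=> z Lz; have := lifted_translate 1 Lz.
- by move=> z Lz; have := lifted_translate (-1) Lz; rewrite rmorphN.
- by exists zlo.
- by exists zhi.
- exact: lifted_conn.
- exact: lifted_ulc.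
- move=> c cc cL c0 c1; apply: (lifted_sep cc cL _ c0 c1) => w Lw.
  by rewrite lo ?hi.
Qed.

(** A point of the component of [cover z] in the complement of [K] lifts to a point
    which is reached from [z] without crossing [lifted].  Such lifts are filled,
    hence lie at bounded heights, and the component lies in a compact
    annulus. *)
Lemma filled_Fill lo hi z : barrier lifted lo hi -> filled lifted lo hi z -> Fill K (cover z).
Proof.
move=> bL fz; have [Kz|nKz] := pselect (K (cover z)); [by left|right; split => //].
pose reach w := exists c : R -> R * R, [/\ curve c, forall t, ~ lifted (c t), c 0 = z & c 1 = w].
have reach_seg w w' : reach w -> (forall t, ~ lifted (seg w w' t)) -> reach w'.
  move=> [c [cc cL c0 c1]] sL; exists (ccat c (seg w w')).
  have e : c 1 = seg w w' 0 by rewrite seg0.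
  split; first exact: curve_ccat (curve_seg _ _).
  - exact: (ccat_all (P := fun z => ~ lifted z)).
  - by rewrite ccat0.
  - by rewrite ccat1 seg1.
have reach_filled w : reach w -> filled lifted lo hi w.
  move=> [c [cc cL c0 c1]]; have [nU nD] := fz; split.
    move=> [c' hc']; apply: nU; exists (ccat c c'); exact: up_path_cat hc'.
  move=> [c' hc']; apply: nD; exists (ccat (fun t => refl (c t)) c').
  apply: up_path_cat hc'; [exact: curve_comp continuous_refl cc| |by rewrite c0|by rewrite c1].
  by move=> t; rewrite /reflected /= reflK.
pose B := [set p | exists2 w, reach w & cover w = p].
have rz : reach z.
  by exists (fun=> z); split => //; exact: curve_cst.
set C := connected_component (~` K) (cover z).
have CB : C `<=` B.
  apply: (@connected_locally_constant _ C B); first exact: component_connected.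
    move=> p Cp; have nKp : ~ K p by exact: connected_component_sub Cp.
    have [w wp] := cover_surj p.
    have : nbhs w (~` lifted).
      apply: open_nbhs_nbhs; split; last by rewrite /lifted /= wp.
      exact: closed_openC lifted_closed.
    move=> /nbhs_closeP[e e0 he].
    rewrite -wp; apply: filterS (near_section w e0) => q [wq qE] Cq.
    have sg t : ~ lifted (seg w (section_at w q) t) by apply: he; exact: seg_close.
    have tr v v' (n : int) : (forall t, ~ lifted (seg v v' t)) ->
        forall t, ~ lifted (seg (v.1 + n%:~R, v.2) (v'.1 + n%:~R, v'.2) t).
      move=> h t; have -> : seg (v.1 + n%:~R, v.2) (v'.1 + n%:~R, v'.2) t =
          ((seg v v' t).1 + n%:~R, (seg v v' t).2).
        by rewrite /seg /=; congr pair; ring.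
      by move=> /lifted_translateE; exact: h.
    split=> -[x rx xE].
      have [n hn] := cover_inj (esym xE); rewrite hn in rx.
      exists ((section_at w q).1 + n%:~R, (section_at w q).2); last by rewrite cover_translate.
      by apply: reach_seg rx _; exact: tr.
    have xE' : cover (section_at w q) = cover x by rewrite xE.
    have [n hn] := cover_inj xE'; rewrite hn in rx.
    exists (w.1 + n%:~R, w.2); last by rewrite cover_translate.
    apply: reach_seg rx _; apply: tr => t; have [s ->] := seg_rev w (section_at w q) t.
    exact: sg.
  by exists (cover z); split; [exact: connected_component_refl|exists z].
(* A compact annulus, parametrised by one period of the strip. *)
pose Q := [set cover w | w in [set w | 0 <= w.1 <= 1 /\ lo <= w.2 <= hi]].
have cQ : compact Q.
  apply: continuous_compact; first by apply: continuous_subspaceT; exact: continuous_cover.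
  have cI (x y : R) : compact [set t : R | x <= t <= y].
    have -> : [set t : R | x <= t <= y] = `[x, y]%classic by apply/seteqP; split => t /=; rewrite in_itv.
    exact: segment_compact.
  exact: (compact_setX (cI 0 1) (cI lo hi)).
have CQ : C `<=` Q.
  move=> p /CB[w rw <-]; have hw := filled_strip bL (reach_filled w rw).
  exists (w.1 + (- Num.floor w.1)%:~R, w.2); last by rewrite cover_translate.
  split => //=; have /andP[f1 f2] := floor_itv w.1; rewrite intrD in f2.
  by rewrite rmorphN; apply/andP; split; lra.
have Qcl : closed Q.
  pose vl (p : annulus R) : R * R := \val p.
  have cV : compact [set vl p | p in Q].
    apply: continuous_compact cQ; apply: continuous_subspaceT; exact: continuous_val.
  have clV := compact_closed (@norm_hausdorff _ _) cV.
  have -> : Q = vl @^-1` [set vl p | p in Q].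
    by apply/seteqP; split => p /=; [move=> Qp; exists p|move=> [q Qq /val_inj <-]].
  by apply: closed_comp clV => p _; exact: continuous_val.
apply: subclosed_compact cQ _; first exact: closed_closure.
by rewrite [X in _ `<=` X](closure_id Q).1//; exact: closureS.
Qed.

End EssentialContinuum.

(** * Nielsen classes *)

Section NielsenClasses.
Context {R : realType}.
Implicit Types (u v w z : R * R) (p q : annulus R).
Variables (g : annulus R -> annulus R) (G : R * R -> R * R) (D : int).
Hypothesis gG : self_lift g G D.

Lemma fixed_index p z : g p = p -> cover z = p -> exists k : int, G z = (z.1 + k%:~R, z.2).
Proof.
have [_ GE _] := gG => gp zp; apply: cover_inj.
by rewrite GE zp gp.
Qed.

Lemma index_fixed z (k : int) : G z = (z.1 + k%:~R, z.2) -> g (cover z) = cover z.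
Proof. by have [_ GE _] := gG => Gz; rewrite -GE Gz cover_translate. Qed.

Lemma index_translate z (k n : int) : G z = (z.1 + k%:~R, z.2) ->
  G (z.1 + n%:~R, z.2) = (z.1 + n%:~R + (k + (D - 1) * n)%:~R, z.2).
Proof.
have [_ _ GD] := gG => Gz; rewrite (lift_translate GD) Gz /=; congr pair.
by rewrite mulrBl mul1r !intrD rmorphN /=; ring.
Qed.

(** A path between the two fixed points lifts to a curve whose ends have the same
    index, because it and its image under [G] have the same displacement.
    Conversely, if [z] and [w'] have the index [k], the segment joining them and its
    image under [G] translated by [- k] have the same ends, and are joined by
    the linear homotopy. *)
Lemma nielsen_equiv_index z w (k : int) : G z = (z.1 + k%:~R, z.2) ->
  nielsen_equiv g (cover z) (cover w) <->
  exists2 w', cover w' = cover w & G w' = (w'.1 + k%:~R, w'.2).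
Proof.
have [Gc GE GD] := gG => Gz; split.
- move=> [c [[cc c0 c1] hom]].
  have [u hu u0] := path_lift_exists cc (esym c0).
  have ccu : cover (u 1) = cover w by rewrite hu.2 clamp1.
  exists (u 1) => //.
  have dgc : displacement (g \o c) (G (u 1) - G (u 0)).
    exists (fun t => G (u t)) => //; split; first exact: (curve_comp Gc hu.1).
    by move=> t; rewrite GE hu.2.
  have := displacement_homotopic hom dgc (ex_intro2 _ _ u hu erefl).
  rewrite u0 Gz => /eqP; rewrite subr_eq => /eqP ->.
  rewrite [LHS]surjective_pairing /=; congr pair; last by rewrite subrK.
  by rewrite addrA subrK.
- move=> [w' <- Gw'].
  pose s := seg z w'; have sc := curve_seg z w'.
  exists (fun t => cover (s t)).
  have := path_lift_is_path sc; rewrite seg0 seg1 => hp; split => //.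
  pose m a t : R * R := ((1 - a) * (G (s t)).1 + a * ((s t).1 + k%:~R),
     (1 - a) * (G (s t)).2 + a * (s t).2).
  pose M (x : R * R) : R * R := m x.1 x.2.
  have Mc : continuous M.
    have cs : continuous (fun x : R * R => s x.2).
      move=> x; apply: (@continuous_comp _ _ _ snd s); first exact: cvg_snd.
      exact: sc.1.
    have cG : continuous (fun x : R * R => G (s x.2)).
      by move=> x; exact: (continuous_comp (cs x) (@Gc _)).
    have c1 : continuous (fun x : R * R => x.1) by move=> x; exact: cvg_fst.
    have c1' : continuous (fun x : R * R => 1 - x.1).
      by move=> x; apply: cvgB; [exact: cvg_cst|exact: c1].
    apply: continuous_plane => x; apply: cvgD; apply: cvgM.
    + exact: c1'.
    + exact: (continuous_fst cG).
    + exact: c1.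
    + by apply: cvgD; [exact: (continuous_fst cs)|exact: cvg_cst].
    + exact: c1'.
    + exact: (continuous_snd cG).
    + exact: c1.
    + exact: (continuous_snd cs).
  exists (fun x => cover (M x)); split.
  + apply: continuous_subspaceT => x.
    exact: (continuous_comp (Mc x) (@continuous_cover R _)).
  + move=> t _; have -> : M (0, t) = m 0 t by [].
    by rewrite /m subr0 !mul1r !mul0r !addr0 -surjective_pairing GE.
  + move=> t _; have -> : M (1, t) = m 1 t by [].
    by rewrite /m subrr !mul0r !mul1r !add0r cover_translate.
  + move=> t _; have [-> ->] : M (t, 0) = m t 0 /\ M (t, 1) = m t 1 by [].
    have e (a : R) : (1 - t) * a + t * a = a by ring.
    have s0 : s 0 = z by exact: seg0.
    have s1 : s 1 = w' by exact: seg1.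
    have -> : m t 0 = (z.1 + k%:~R, z.2) by rewrite /m s0 Gz; congr pair; exact: e.
    have -> : m t 1 = (w'.1 + k%:~R, w'.2) by rewrite /m s1 Gw'; congr pair; exact: e.
    by rewrite !cover_translate /= s0 s1 (index_fixed Gz) (index_fixed Gw').
Qed.

Lemma nielsen_classE z (k : int) : G z = (z.1 + k%:~R, z.2) ->
  nielsen_class g (cover z) =
  [set q | exists w, exists2 l : int, cover w = q /\ G w = (w.1 + l%:~R, w.2) &
     (D - 1 %| l - k)%Z].
Proof.
move=> Gz; apply/seteqP; split => [q [gq nq]|q [w [l [wq Gw] lk]]].
- have [w wq] := cover_surj q; rewrite -wq in nq.
  have [w' w'w Gw'] := (nielsen_equiv_index w Gz).1 nq.
  by exists w', k; [rewrite w'w|rewrite subrr dvdz0].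
- rewrite -wq; split; first exact: index_fixed Gw.
  apply/(nielsen_equiv_index w Gz).
  have /dvdzP[m hm] := lk.
  exists (w.1 + (- m)%:~R, w.2); first by rewrite cover_translate.
  rewrite (index_translate _ Gw) /=.
  by have -> : l + (D - 1) * - m = k by rewrite mulrN mulrC -hm; ring.
Qed.

(** By [nielsen_equiv_index] and [index_translate], the classes correspond to the
    residues modulo [D - 1] of the indices; choosing one point of each index
    gives representatives. *)
Lemma nielsen_complete_lift (S : set (annulus R)) : D != 1 ->
  (forall k : int, exists z, G z = (z.1 + k%:~R, z.2) /\ S (cover z)) ->
  (nielsen_classes g #= `I_(absz (D - 1)))%card /\
  forall C, nielsen_classes g C -> C `&` S !=set0.
Proof.
move=> D1 /choice[zk hzk]; set N := absz (D - 1).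
have D0 : D - 1 != 0 by rewrite subr_eq0.
have N0 : (N : int) != 0 by rewrite /N; move: D0; case: (D - 1) => // -[].
have dvdN x : (D - 1 %| x)%Z = (N %| x)%Z by rewrite !dvdzE.
have cls p : g p = p -> exists k : int, nielsen_class g p = nielsen_class g (cover (zk k)).
  move=> gp; have [z zp] := cover_surj p; have [k Gz] := fixed_index gp zp.
  by exists k; rewrite -zp (nielsen_classE Gz) (nielsen_classE (hzk k).1).
have cls_mod (k l : int) : (D - 1 %| l - k)%Z ->
    nielsen_class g (cover (zk l)) = nielsen_class g (cover (zk k)).
  move=> lk; rewrite (nielsen_classE (hzk k).1) (nielsen_classE (hzk l).1).
  apply/seteqP; split => q [w [m h hm]]; exists w, m => //.
    by rewrite -(subrK l m) -addrA rpredD.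
  by rewrite -(subrK k m) -addrA rpredD// -opprB rpredN.
split; last first.
  move=> C [p gp <-]; have [k ->] := cls p gp; exists (cover (zk k)); split; last exact: (hzk k).2.
  rewrite (nielsen_classE (hzk k).1); exists (zk k), k; first by split => //; exact: (hzk k).1.
  by rewrite subrr dvdz0.
have -> : nielsen_classes g = [set nielsen_class g (cover (zk r%:Z)) | r in `I_N].
  apply/seteqP; split => [C [p gp <-]|C [r _ <-]].
    have [k ->] := cls p gp; have k0 := modz_ge0 k N0.
    have kN := ltz_mod k N0.
    exists (absz (k %% N)%Z); last first.
      rewrite gez0_abs//; apply: cls_mod.
      by rewrite dvdN {2}(divz_eq k N) opprD addrCA subrr addr0 rpredN dvdz_mull.
    by rewrite /= -ltz_nat gez0_abs// (lt_le_trans kN)//.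
  by exists (cover (zk r%:Z)) => //; exact: index_fixed (hzk r).1.
apply: inj_card_eq => r s /set_mem /= rN /set_mem /= sN e.
have : nielsen_class g (cover (zk s)) (cover (zk s)).
  rewrite (nielsen_classE (hzk s).1); exists (zk s), s%:Z; first by split => //; exact: (hzk s).1.
  by rewrite subrr dvdz0.
rewrite -e (nielsen_classE (hzk r).1) => -[w [l [wz Gw] lr]].
have [n wE] := cover_inj (esym wz); rewrite wE (index_translate _ (hzk s).1) in Gw.
move: Gw => -[] /addrI/eqP; rewrite eqr_int => /eqP hl.
have sr : (s == r %[mod N])%Z.
  rewrite eqz_mod_dvd -dvdN; move: lr; rewrite -hl addrAC.
  by rewrite rpredDr ?dvdz_mulr.
apply/eqP; rewrite eq_sym -eqz_nat; move: sr.
by rewrite !modz_small//= ltz_nat.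
Qed.

End NielsenClasses.

Lemma iter_stable (T : Type) (f : T -> T) (K : set T) n : f @` K `<=` K ->
  forall x, K x -> K (iter n f x).
Proof. by move=> fK x Kx; elim: n => [//|n IH]; apply: fK; exists (iter n f x). Qed.

(** A point of index [k] is a fixed point of [G] followed by the translation by
    [- k], another lift of [g]. *)
Lemma lift_fixed_in_Fill (R : realType) (g : annulus R -> annulus R) (G : R * R -> R * R)
    (D : int) (K : set (annulus R)) :
  self_lift g G D -> D != 1 -> continuum K -> locally_connected K -> essential K ->
  (forall p, K p -> K (g p)) ->
  forall k : int, exists z, G z = (z.1 + k%:~R, z.2) /\ Fill K (cover z).
Proof.
move=> [Gc GE GD] D1 cK lcK eK gK k.
have [lo [hi bL]] := lifted_barrier cK lcK eK.
pose F z : R * R := ((G z).1 + (- k)%:~R, (G z).2).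
have Fc : continuous F.
  apply: continuous_plane => z; last exact: (continuous_snd Gc).
  by apply: cvgD; [exact: (continuous_fst Gc)|exact: cvg_cst].
have FD z : F (z.1 + 1, z.2) = ((F z).1 + D%:~R, (F z).2).
  by rewrite /F GD /= addrAC.
have FL z : lifted K z -> lifted K (F z).
  by rewrite /lifted /= => Kz; rewrite cover_translate GE; exact: gK.
have [z Fz fz] := plane_fixed_point Fc FD bL D1 FL.
exists z; split; last exact: (filled_Fill cK bL fz).
rewrite -{2 3}Fz /F /= rmorphN subrK; exact: surjective_pairing.
Qed.

Theorem theorem2 (R : realType) (f : annulus R -> annulus R) (d : int)
    (K : set (annulus R)) :
  continuous f ->
  has_degree f d ->
  continuum K ->
  locally_connected K ->
  essential K ->
  f @` K `<=` K ->
  1 < `|d| ->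
  nielsen_complete_on d f (Fill K).
Proof.
move=> fc fd cK lcK eK fK d1.
have [F fF] := self_lift_exists fc fd.
have key n : (1 <= n)%N ->
    (nielsen_classes (iter n f) #= `I_(absz (d ^+ n - 1)))%card /\
    forall C, nielsen_classes (iter n f) C -> C `&` Fill K !=set0.
  move=> n1; have iF := self_lift_iter n fF.
  have D1 : d ^+ n != 1.
    apply: contraTneq d1 => dn.
    have : `|d| ^+ n = 1 by rewrite -normrX dn normr1.
    move=> e; apply/negP => d1; have := @exprn_egt1 _ n _ d1.
    by rewrite e ltxx -lt0n n1.
  apply: (nielsen_complete_lift iF D1).
  exact: lift_fixed_in_Fill iF D1 cK lcK eK (iter_stable n fK).
by split=> n n1; have [] := key n n1.
Qed.
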